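(* Let $S\subset\mathbb{P}^1(\mathbf{k}_\infty)$ be a nonempty open compact subset and let $h\ge 0$ be an integer. Then the space of $h$-admissible measures on $S$ is the dual of the $\mathbf{C}_\infty$-Banach space $(C^h(S),\|\cdot\|_h)$: restricting functionals from $C^h(S)$ to the subspace $P^{(h)}\subset C^h(S)$ is a $\mathbf{C}_\infty$-linear bijection from the space $(C^h(S))^*$ of continuous $\mathbf{C}_\infty$-linear functionals on $C^h(S)$ onto the space of $h$-admissible measures on $S$.
   Context: Let $q$ be a power of a prime $p$, $\pi=1/T$, $\mathbf{k}_\infty=\mathbb{F}_q((\pi))$ with absolute value normalized by $|\pi|=1/q$, and $\mathbf{C}_\infty$ the completion of an algebraic closure of $\mathbf{k}_\infty$. Balls and coordinates. For $a\in\mathbf{k}_\infty$ put $B_a(|\pi|^l)=\{x\in\mathbf{k}_\infty:|x-a|\le|\pi|^l\}$, and $B_\infty(|\pi|^l)=\{x\in\mathbf{k}_\infty:|x|\ge|\pi|^{-l}\}\cup\{\infty\}$ (a ball of radius $|\pi|^l$ about $\infty$). Fix a finite disjoint decomposition $S=\bigsqcup_i B_i$ into such balls of a common radius $|\pi|^{l_0}$. On $B_i$ use the coordinate $t=x$ if $\infty\notin B_i$, and $t=1/x$ (with $t(\infty)=0$) if $\infty\in B_i$. For $a\in B_i$ and an integer $l\ge l_0$, the ball of radius $|\pi|^l$ in $S$ centered at $a$ is $B_a(|\pi|^l)=\{x\in B_i:|t(x)-t(a)|\le|\pi|^l\}$. Locally polynomial functions. For $a\in S$, $l\ge l_0$,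 $j\ge0$ let $\chi(a,l;j;x)=(t(x)-t(a))^j$ if $x\in B_a(|\pi|^l)$ and $0$ otherwise (with $0$-th power $1$). Let $P_l^{(h)}$ be the $\mathbf{C}_\infty$-span of all $\chi(a,l;j;\cdot)$ with $a\in S$, $0\le j\le h$, and $P^{(h)}=\bigcup_{l\ge l_0}P_l^{(h)}$. $h$-admissible measures. A $\mathbf{C}_\infty$-linear functional $\mu$ on $P^{(h)}$ is an $h$-admissible measure on $S$ if there is a constant $C$ (depending only on $\mu$) with $|\mu(\chi(a,l;j;\cdot))|\le C|\pi|^{l(j-h)}$ for all $0\le j\le h$, all sufficiently large $l$, and all $a\in S$. $C^h$ functions. For $f:B_i\to\mathbf{C}_\infty$, viewed as a function of the coordinate $t$, define difference quotients by $\Phi_0f=f$ and $\Phi_nf(t_1,\dots,t_{n+1})=\dfrac{\Phi_{n-1}f(t_1,t_3,\dots,t_{n+1})-\Phi_{n-1}f(t_2,t_3,\dots,t_{n+1})}{t_1-t_2}$ for pairwise distinct $t_1,\dots,t_{n+1}$. The function $f$ is $C^n$ on $B_i$ if $\Phi_nf$ extends to a continuous function $\overline{\Phi_nf}$ on $B_i^{n+1}$. $C^h(S)$ is the space of $f:S\to\mathbf{C}_\infty$ such that $f|_{B_i}$ is $C^h$ for every $i$, with norm $\|f\|_h=\max_i\max_{0\le j\le h}\|\overline{\Phi_j(f|_{B_i})}\|_\infty$, where $\|\cdot\|_\infty$ is the sup norm. *)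

(* Defs.v *)
From HB Require Import structures.
From mathcomp Require Import all_boot all_order all_algebra.
From mathcomp Require Import zify.
From mathcomp Require Import mathcomp_extra boolp classical_sets functions.
From mathcomp Require Import cardinality fsbigop reals topology.

Set Implicit Arguments.
Unset Strict Implicit.
Unset Printing Implicit Defensive.

Import Order.TTheory GRing.Theory Num.Theory.

Local Open Scope classical_set_scope.
Local Open Scope ring_scope.

(* [x : laurent F] is the series \sum_n (x n) pi^n. *)
Record laurent (F : fieldType) := Laurent {
  lcoef :> int -> F;
  lcoefP : exists m : int, forall n, n < m -> lcoef n = 0 }.

HB.instance Definition _ (F : fieldType) := gen_eqMixin (laurent F).
HB.instance Definition _ (F : fieldType) := gen_choiceMixin (laurent F).

Section LaurentField.
Variable F : fieldType.
Implicit Types x y z : laurent F.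

Lemma laurentP x y : (forall n, x n = y n) -> x = y.
Proof.
case: x y => [f fP] [g gP] /= fg.
have {}fg : f = g by apply/funext.
by case: _ / fg gP => gP; congr Laurent; exact: Prop_irrelevance.
Qed.

Definition lbound x (m : int) := forall n, n < m -> x n = 0.

Lemma lbound_le x m m' : m' <= m -> lbound x m -> lbound x m'.
Proof. by move=> mm' xm n nm'; apply: xm; exact: lt_le_trans mm'. Qed.

Lemma lbound_ex2 x y : exists m, lbound x m /\ lbound y m.
Proof.
have [[a xa] [b yb]] := (lcoefP x, lcoefP y).
by exists (Num.min a b); split; [apply: lbound_le xa|apply: lbound_le yb];
  rewrite ge_min lexx ?orbT.
Qed.

Fact laurent0_bound : exists m : int, forall n, n < m -> (0 : F) = 0.
Proof. by exists 0. Qed.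
Definition laurent0 := @Laurent F (fun=> 0) laurent0_bound.

Fact monom_bound (c : F) (k : int) :
  exists m : int, forall n, n < m -> (if n == k then c else 0) = 0.
Proof. by exists k => n nk; rewrite lt_eqF. Qed.
(* c pi^k *)
Definition monom (c : F) (k : int) := @Laurent F _ (monom_bound c k).

Fact laurentN_bound x : exists m : int, forall n, n < m -> - x n = 0.
Proof. by have [m xm] := lcoefP x; exists m => n /xm ->; rewrite oppr0. Qed.
Definition laurentN x := Laurent (laurentN_bound x).

Fact laurentD_bound x y : exists m : int, forall n, n < m -> x n + y n = 0.
Proof.
by have [m [xm ym]] := lbound_ex2 x y; exists m => n nm; rewrite xm ?ym ?addr0.
Qed.
Definition laurentD x y := Laurent (laurentD_bound x y).

(* Cauchy product; the sum is finitely supported *)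
Definition lconv x y (n : int) : F := \sum_(i \in [set: int]) (x i * y (n - i)).

Lemma lconv_lt x y a b n : lbound x a -> lbound y b -> n < a + b ->
  lconv x y n = 0.
Proof.
move=> xa yb nab; apply: fsbig1 => i _.
have [ia|ai] := ltP i a; first by rewrite xa ?mul0r.
by rewrite yb ?mulr0 //; lia.
Qed.

Definition lpoly x (a : int) N : {poly F} := \poly_(k < N) x (a + k%:Z).


Lemma coef_lpoly x a N k : (lpoly x a N)`_k = if (k < N)%N then x (a + k%:Z) else 0.
Proof. by rewrite coef_poly. Qed.

Lemma lconvE x y a b (m N : nat) : lbound x a -> lbound y b -> (m < N)%N ->
  lconv x y (a + b + m%:Z) = (lpoly x a N * lpoly y b N)`_m.
Proof.
move=> xa yb mN; rewrite /lconv.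
have inj_s : injective (fun k : nat => a + k%:Z) by move=> k k' /addrI [].
rewrite (fsbigE [seq a + k%:Z | k <- iota 0 m.+1]) //; first last.
- move=> i _ is_; have [ia|ai] := ltP i a; first by rewrite xa ?mul0r.
  rewrite yb ?mulr0 //; rewrite ltNge; apply: contra is_ => bi.
  by apply/mapP; exists `|i - a|%N; [rewrite mem_iota; lia|lia].
- by rewrite (map_inj_uniq inj_s) iota_uniq.
under eq_bigl do rewrite in_setT.
rewrite big_map coefM -[iota 0 m.+1]/(index_iota 0 m.+1) big_mkord.
apply: eq_bigr => -[j /= jm] _.
rewrite !coef_lpoly (leq_trans jm mN) (leq_ltn_trans (leq_subr _ _) mN).
by congr (_ * y _); lia.
Qed.

Fact laurentM_bound x y : exists m : int, forall n, n < m -> lconv x y n = 0.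
Proof.
have [[a xa] [b yb]] := (lcoefP x, lcoefP y).
by exists (a + b) => n; exact: lconv_lt.
Qed.
Definition laurentM x y := Laurent (laurentM_bound x y).

Lemma lboundM x y a b : lbound x a -> lbound y b -> lbound (laurentM x y) (a + b).
Proof. by move=> xa yb n; exact: lconv_lt. Qed.

Lemma laurentP_bound x y a : lbound x a -> lbound y a ->
  (forall m : nat, x (a + m%:Z) = y (a + m%:Z)) -> x = y.
Proof.
move=> xa ya xy; apply: laurentP => n; have [na|an] := ltP n a.
  by rewrite xa ?ya.
by have -> : n = a + `|n - a|%N%:Z by lia.
Qed.

Lemma lpolyM_trunc x y a b (m N : nat) (p : {poly F}) :
  lbound x a -> lbound y b -> (m < N)%N ->
  (lpoly (laurentM x y) (a + b) N * p)`_m = (lpoly x a N * lpoly y b N * p)`_m.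
Proof.
move=> xa yb mN; rewrite !coefM; apply: eq_bigr => -[j /= jm] _.
have jN : (j < N)%N by exact: leq_trans mN.
by rewrite coef_lpoly jN; congr (_ * _); exact: lconvE.
Qed.

Lemma laurentMC : commutative laurentM.
Proof.
move=> x y; have [[a xa] [b yb]] := (lcoefP x, lcoefP y).
apply: (laurentP_bound (lboundM xa yb)); first by rewrite addrC; exact: lboundM.
move=> m; rewrite [LHS](lconvE xa yb (ltnSn m)) mulrC [in RHS](addrC a).
by rewrite [RHS](lconvE yb xa (ltnSn m)).
Qed.

Lemma laurentMA : associative laurentM.
Proof.
move=> x y z; have [[a xa] [b yb] [c zc]] := And3 (lcoefP x) (lcoefP y) (lcoefP z).
have bl := lboundM xa (lboundM yb zc).
apply: (laurentP_bound bl) => [|m].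
  by rewrite addrA; exact: lboundM (lboundM xa yb) zc.
rewrite [LHS](lconvE xa (lboundM yb zc) (ltnSn m)) addrA.
rewrite [RHS](lconvE (lboundM xa yb) zc (ltnSn m)).
rewrite mulrC (lpolyM_trunc _ yb zc (ltnSn m)).
by rewrite (lpolyM_trunc _ xa yb (ltnSn m)) [in LHS]mulrC mulrA.
Qed.

Lemma laurentMDl : left_distributive laurentM laurentD.
Proof.
move=> x y z; have [a [xa ya]] := lbound_ex2 x y; have [c zc] := lcoefP z.
have xya : lbound (laurentD x y) a by move=> n na /=; rewrite xa ?ya ?addr0.
apply: (laurentP_bound (lboundM xya zc)).
  by move=> n na /=; rewrite !(lconv_lt _ zc na) ?addr0.
move=> m; rewrite /= (lconvE xya zc (ltnSn m)) (lconvE xa zc (ltnSn m)).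
rewrite (lconvE ya zc (ltnSn m)) -coefD -mulrDl.
congr ((_ * _ : {poly F})`_m).
by apply/polyP => k; rewrite coefD !coef_lpoly; case: ifP; rewrite ?addr0.
Qed.

Lemma lbound_monom c k : lbound (monom c k) k.
Proof. by move=> n nk /=; rewrite lt_eqF. Qed.

Lemma laurentMmonom c k x n : laurentM (monom c k) x n = c * x (n - k).
Proof.
rewrite /= /lconv (fsbigE [:: k]) //=; last first.
  by move=> i _; rewrite inE => /negbTE ->; rewrite mul0r.
by rewrite big_cons big_nil in_setT eqxx addr0.
Qed.

Lemma laurentM1 : left_id (monom 1 0) laurentM.
Proof. by move=> x; apply: laurentP => n; rewrite laurentMmonom subr0 mul1r. Qed.

Lemma laurent_addA : associative laurentD.
Proof. by move=> x y z; apply: laurentP => n /=; rewrite addrA. Qed.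
Lemma laurent_addC : commutative laurentD.
Proof. by move=> x y; apply: laurentP => n /=; rewrite addrC. Qed.
Lemma laurent_add0 : left_id laurent0 laurentD.
Proof. by move=> x; apply: laurentP => n /=; rewrite add0r. Qed.
Lemma laurent_addN : left_inverse laurent0 laurentN laurentD.
Proof. by move=> x; apply: laurentP => n /=; rewrite addNr. Qed.
Lemma laurent_1neq0 : monom 1 0 <> laurent0.
Proof. by move/(congr1 (fun x : laurent F => x 0)) => /eqP; rewrite /= oner_eq0. Qed.

End LaurentField.

HB.instance Definition _ (F : fieldType) := GRing.isZmodule.Build (laurent F)
  (@laurent_addA F) (@laurent_addC F) (@laurent_add0 F) (@laurent_addN F).
HB.instance Definition _ (F : fieldType) :=
  GRing.Zmodule_isComNzRing.Build (laurent F) (@laurentMA F) (@laurentMC F)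
    (@laurentM1 F) (@laurentMDl F) (introN eqP (@laurent_1neq0 F)).

Section LaurentInverse.
Variable F : fieldType.
Implicit Types x y : laurent F.

Lemma laurent_coef0 n : (0 : laurent F) n = 0. Proof. by []. Qed.
Lemma laurent_coef1 n : (1 : laurent F) n = (n == 0)%:R.
Proof. by rewrite -[LHS]/(if n == 0 then 1 else 0 : F); case: (n == 0). Qed.
Lemma laurent_coefD x y n : (x + y) n = x n + y n. Proof. by []. Qed.
Lemma laurent_coefN x n : (- x) n = - x n. Proof. by []. Qed.
Lemma laurent_coefM x y n :
  (x * y) n = \sum_(i \in [set: int]) (x i * y (n - i)).
Proof. by []. Qed.

Definition is_lord x (n : int) := x n != 0 /\ lbound x n.

Lemma lord_uniq x n n' : is_lord x n -> is_lord x n' -> n = n'.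
Proof.
move=> [xn xltn] [xn' xltn']; apply/eqP; rewrite eq_le.
by apply/andP; split; rewrite leNgt; apply/negP;
  [move=> /xltn e; rewrite e eqxx in xn'|move=> /xltn' e; rewrite e eqxx in xn].
Qed.

Lemma lord_exists x : x != 0 -> exists n, is_lord x n.
Proof.
move=> x0; have [a xa] := lcoefP x.
have ex : exists k : nat, x (a + k%:Z) != 0.
  apply: contrapT => nex; move/eqP: x0; apply.
  apply: (laurentP_bound xa) => // m; rewrite laurent_coef0; apply/eqP.
  by apply/negPn/negP => xm; apply: nex; exists m.
exists (a + (ex_minn ex)%:Z); case: ex_minnP => k xk kmin; split => // n nk.
have [na|an] := ltP n a; first exact: xa.
have -> : n = a + `|n - a|%N%:Z by lia.
by apply/eqP/negPn/negP => /kmin; lia.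
Qed.

(* coefficients of the inverse of a power series with coefficients [u], u 0 != 0 *)
Fixpoint inv_seq (u : nat -> F) (n : nat) : seq F :=
  if n is m.+1 then
    let s := inv_seq u m in
    rcons s ((u 0)^-1 * ((m == 0)%:R - \sum_(j < m) u (m - j)%N * s`_j))
  else [::].

Lemma size_inv_seq u n : size (inv_seq u n) = n.
Proof. by elim: n => //= n IH; rewrite size_rcons IH. Qed.

Lemma nth_inv_seq u n k : (k < n)%N -> (inv_seq u n)`_k = (inv_seq u k.+1)`_k.
Proof.
elim: n => // n IH; rewrite ltnS leq_eqVlt => /orP[/eqP -> //|kn].
by rewrite [LHS]/= nth_rcons size_inv_seq kn IH.
Qed.

Lemma inv_seqP u m : u 0 != 0 ->
  \sum_(j < m.+1) u (m - j)%N * (inv_seq u j.+1)`_j = (m == 0)%:R.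
Proof.
move=> u0; rewrite big_ord_recr /= subnn nth_rcons size_inv_seq ltnn eqxx.
rewrite mulVKf // addrC -addrA [X in _ + X](_ : _ = 0) ?addr0 // addrC.
rewrite -sumrB big1 // => -[j /= jm] _.
by rewrite -[rcons _ _]/(inv_seq u j.+1) -(nth_inv_seq u jm) subrr.
Qed.

Lemma laurent_inv_ex x : x != 0 -> exists y, y * x = 1.
Proof.
move=> /lord_exists [a [xa0 xa]].
pose u (k : nat) := x (a + k%:Z).
have u0 : u 0 != 0 by rewrite /u addr0.
pose g (n : int) := if n < - a then 0 else (inv_seq u `|n + a|.+1)`_`|n + a|.
have gb : exists m, forall n, n < m -> g n = 0 by exists (- a) => n; rewrite /g => ->.
exists (Laurent gb); rewrite mulrC.
have ga : lbound (Laurent gb) (- a) by move=> n na /=; rewrite /g na.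
apply: (laurentP_bound (lboundM xa ga)) => [n|m].
  by rewrite subrr => n0; rewrite laurent_coef1 lt_eqF.
rewrite [LHS](lconvE xa ga (ltnSn m)) laurent_coef1 subrr add0r.
rewrite mulrC coefM -[(m%:Z == 0)%:R]/((m == 0)%N%:R) -(inv_seqP m u0).
apply: eq_bigr => -[j /= jm] _.
rewrite !coef_lpoly jm ltnS leq_subr mulrC; congr (_ * _).
rewrite /= /g ifF; last by lia.
by have -> : absz (- a + j%:Z + a) = j by lia.
Qed.

Definition laurentV x : laurent F := xget 0 [set y | y * x = 1].

Fact laurentVP x : x != 0 -> laurentV x * x = 1.
Proof. by move=> /laurent_inv_ex [y yx]; rewrite /laurentV; case: xgetP => [//|/(_ y)]. Qed.

Fact laurentV0 : laurentV 0 = 0.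
Proof.
rewrite /laurentV; case: xgetP => // y _ /= /eqP.
by rewrite mulr0 eq_sym oner_eq0.
Qed.

End LaurentInverse.

HB.instance Definition _ (F : fieldType) := GRing.ComNzRing_isField.Build
  (laurent F) (@laurentVP F) (@laurentV0 F).

Section AbsoluteValue.
Variables (R : realType) (F : finFieldType).
Implicit Types x y : laurent F.

Definition lord x : int := xget 0 (is_lord x).

(* |x| = q^(-ord x), with q = #|F| *)
Definition kabs x : R := if x == 0 then 0 else #|F|%:R ^ (- lord x).

Definition piK : laurent F := monom 1 1.

Definition pirad (l : int) : R := kabs piK ^ l.

Lemma lordE x n : is_lord x n -> lord x = n.
Proof. by move=> xn; exact: lord_uniq (xgetI 0 xn) xn. Qed.

Lemma kabs_pi : kabs piK = #|F|%:R^-1.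
Proof.
have pi1 : is_lord piK 1.
  by split; [rewrite /= oner_eq0|exact: lbound_monom].
rewrite /kabs ifF; last by apply/eqP => p0; case: pi1; rewrite p0 eqxx.
by rewrite (lordE pi1) exprN1.
Qed.

Lemma card_ge1 : 1 <= #|F|%:R :> R.
Proof. by rewrite ler1n; apply/card_gt0P; exists 0. Qed.

Lemma card_gt0r : 0 < #|F|%:R :> R.
Proof. exact: lt_le_trans ltr01 card_ge1. Qed.

Lemma pirad_gt0 l : 0 < pirad l.
Proof. by rewrite /pirad kabs_pi exprz_gt0 // invr_gt0 card_gt0r. Qed.

Lemma piradE l : pirad l = #|F|%:R ^ (- l).
Proof. by rewrite /pirad kabs_pi exprz_inv. Qed.

Lemma pirad_le l l' : l <= l' -> pirad l' <= pirad l.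
Proof. by move=> ll'; rewrite !piradE ler_weXz2l ?card_ge1 // lerN2. Qed.

Lemma kabs_lord x n : is_lord x n -> kabs x = pirad n.
Proof.
move=> xn; rewrite piradE /kabs (lordE xn) ifF //.
by apply/eqP => x0; case: xn; rewrite x0 eqxx.
Qed.

Lemma kabs0 : kabs 0 = 0. Proof. by rewrite /kabs eqxx. Qed.

Lemma kabs_ge0 x : 0 <= kabs x.
Proof.
have [->|/lord_exists[n /kabs_lord ->]] := eqVneq x 0; first by rewrite kabs0.
exact/ltW/pirad_gt0.
Qed.

Lemma kabs_eq0 x : kabs x = 0 -> x = 0.
Proof.
have [//|/lord_exists[n /kabs_lord ->] p0] := eqVneq x 0.
by have := pirad_gt0 n; rewrite p0 ltxx.
Qed.

Lemma is_lordM x y n m : is_lord x n -> is_lord y m -> is_lord (x * y) (n + m).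
Proof.
move=> [x0 xn] [y0 ym]; split; last exact: lboundM.
rewrite -[n + m]addr0 -[_ (_ + 0)]/(lconv x y (n + m + 0%N%:Z)).
rewrite (lconvE xn ym (ltnSn 0)) coefM big_ord1 !coef_lpoly /= !addr0.
by rewrite mulf_neq0.
Qed.

Lemma kabsM : {morph kabs : x y / x * y}.
Proof.
move=> x y; have [->|x0] := eqVneq x 0; first by rewrite mul0r kabs0 mul0r.
have [->|y0] := eqVneq y 0; first by rewrite mulr0 kabs0 mulr0.
have [[n xn] [m ym]] := (lord_exists x0, lord_exists y0).
rewrite (kabs_lord xn) (kabs_lord ym) (kabs_lord (is_lordM xn ym)).
by rewrite /pirad expfzDr // kabs_pi invr_eq0 gt_eqF ?card_gt0r.
Qed.

Lemma lbound_kabs x n : lbound x n -> kabs x <= pirad n.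
Proof.
have [->|/lord_exists[m xm] xn] := eqVneq x 0.
  by rewrite kabs0 ltW ?pirad_gt0.
rewrite (kabs_lord xm) pirad_le // leNgt; apply/negP => /xn e.
by case: xm; rewrite e eqxx.
Qed.

Lemma kabsD x y : kabs (x + y) <= Num.max (kabs x) (kabs y).
Proof.
have [->|x0] := eqVneq x 0; first by rewrite add0r le_max lexx orbT.
have [->|y0] := eqVneq y 0; first by rewrite addr0 le_max lexx.
have [[n xn] [m ym]] := (lord_exists x0, lord_exists y0).
rewrite (kabs_lord xn) (kabs_lord ym) le_max.
wlog nm : x y n m x0 y0 xn ym / n <= m.
  move=> H; have [nm|/ltW mn] := leP n m; first exact: H x0 y0 xn ym nm.
  by rewrite addrC orbC; exact: H y0 x0 ym xn mn.
apply/orP; left; apply: lbound_kabs => k kn; rewrite laurent_coefD.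
by rewrite (xn.2 _ kn) (ym.2 _ (lt_le_trans kn nm)) addr0.
Qed.

End AbsoluteValue.

Section NormGeneric.
Variables (R : realType) (U : zmodType) (N : U -> R).

Definition cauchy_for (u : nat -> U) := forall e, 0 < e ->
  exists n0, forall n m, (n0 <= n)%N -> (n0 <= m)%N -> N (u n - u m) < e.

Definition cvg_for (u : nat -> U) (l : U) := forall e, 0 < e ->
  exists n0, forall n, (n0 <= n)%N -> N (u n - l) < e.

Definition complete_for (V : set U) := forall u, (forall n, V (u n)) ->
  cauchy_for u -> exists2 l, V l & cvg_for u l.

End NormGeneric.

Definition nonarch_absval (R : realType) (K : fieldType) (v : K -> R) :=
  [/\ forall x, 0 <= v x, forall x, v x = 0 <-> x = 0,
      {morph v : x y / x * y} & forall x y, v (x + y) <= Num.max (v x) (v y)].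

Lemma kabs_nonarch (R : realType) (F : finFieldType) :
  nonarch_absval (@kabs R F).
Proof.
split; [exact: kabs_ge0| |exact: kabsM|exact: kabsD].
by move=> x; split=> [/kabs_eq0|->] //; exact: kabs0.
Qed.

(* C_oo : an algebraic closure [kbar] of k_oo, and a completion [Cinf] of it for
   an absolute value extending that of k_oo. *)
Record Cinfty (R : realType) (F : finFieldType) := {
  kbar : closedFieldType;
  kbar_of : {rmorphism laurent F -> kbar};
  kbar_algebraic : forall z : kbar, algebraicOver kbar_of z;
  Cinf :> fieldType;
  Cinf_of : {rmorphism kbar -> Cinf};
  cabs : Cinf -> R;
  cabs_nonarch : nonarch_absval cabs;
  cabs_extends : forall x, cabs (Cinf_of (kbar_of x)) = kabs R x;
  kbar_dense : forall (z : Cinf) (e : R), 0 < e ->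
    exists y : kbar, cabs (z - Cinf_of y) < e;
  Cinf_complete : complete_for cabs [set: Cinf] }.

Definition kC (R : realType) (F : finFieldType) (C : Cinfty R F)
  (x : laurent F) : C := Cinf_of C (kbar_of C x).

(* [None] is the point at infinity; [R] is where the absolute value takes its
   values. *)
Definition P1 (R : realType) (F : finFieldType) : Type := option (laurent F).

HB.instance Definition _ (R : realType) (F : finFieldType) :=
  Choice.on (P1 R F).

Section ProjectiveLine.
Variables (R : realType) (F : finFieldType).
Implicit Types (x a : P1 R F) (l : int).

Definition pball a l : set (P1 R F) := fun x =>
  match a, x with
  | Some a', Some x' => kabs R (x' - a') <= pirad R F l
  | Some _, None => False
  | None, Some x' => kabs R x' >= pirad R F (- l)
  | None, None => True
  end.

Lemma pball_le a l l' : l <= l' -> pball a l' `<=` pball a l.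
Proof.
move=> ll'; case: a => [a|] [x|] //= H.
  by apply: le_trans H _; exact: pirad_le.
by apply: le_trans H; apply: pirad_le; rewrite lerN2.
Qed.

Definition P1_open (U : set (P1 R F)) :=
  forall a, U a -> exists l, pball a l `<=` U.

Fact P1_openT : P1_open setT. Proof. by move=> a _; exists 0. Qed.

Fact P1_openI : setI_closed P1_open.
Proof.
move=> U V oU oV a [/oU[l lU] /oV[l' lV]]; exists (Num.max l l') => x xa.
by split; [apply: lU|apply: lV]; apply: pball_le xa; rewrite le_max lexx ?orbT.
Qed.

Fact P1_open_bigU (I : Type) (f : I -> set (P1 R F)) :
  (forall i, P1_open (f i)) -> P1_open (\bigcup_i f i).
Proof.
by move=> fo a [i _ /fo[l lf]]; exists l => x /lf fx; exists i.
Qed.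

End ProjectiveLine.

HB.instance Definition _ (R : realType) (F : finFieldType) :=
  isOpenTopological.Build (P1 R F) (@P1_openT R F) (@P1_openI R F)
    (@P1_open_bigU R F).

Definition ball_decomposition (R : realType) (F : finFieldType)
    (S : set (P1 R F)) (m : nat) (c : 'I_m -> P1 R F) (l0 : int) :=
  S = \bigcup_i pball (c i) l0 /\ trivIset setT (fun i => pball (c i) l0).

(* 1/x at oo is 0; the value of the coordinate at [None] is irrelevant when
   oo \notin B *)
Definition coord (R : realType) (F : finFieldType) (B : set (P1 R F))
    (x : P1 R F) : laurent F :=
  if None \in B then oapp (fun y => y^-1) 0 x else odflt 0 x.

Section FunctionSpaces.
Variables (R : realType) (F : finFieldType) (C : Cinfty R F).
Variables (S : set (P1 R F)) (m : nat) (c : 'I_m -> P1 R F) (l0 : int) (h : nat).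

Local Notation pirad := (pirad R F).
Local Notation kabs := (kabs R).
Local Notation cabs := (@cabs R F C).

Definition block (i : 'I_m) : set S := fun x => pball (c i) l0 (\val x).

Definition tco (i : 'I_m) (x : S) : laurent F :=
  coord (pball (c i) l0) (\val x).

(* only meaningful for a in B_i *)
Definition Sball (i : 'I_m) (a : S) (l : int) : set S :=
  [set x | block i x /\ kabs (tco i x - tco i a) <= pirad l].

Definition chi (i : 'I_m) (a : S) (l : int) (j : nat) : S -> C^o :=
  fun x => if x \in Sball i a l then kC C (tco i x - tco i a) ^+ j else 0.

Definition lspan (U : lmodType C) (E : set U) : set U :=
  [set f | exists n (k : 'I_n -> C) (e : 'I_n -> U),
    (forall i, E (e i)) /\ f = \sum_i k i *: e i].

Definition locpoly_at (l : int) : set (S -> C^o) :=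
  lspan [set f | exists i a j, [/\ block i a, (j <= h)%N & f = chi i a l j]].

Definition locpoly : set (S -> C^o) :=
  \bigcup_(l in [set l : int | l0 <= l]) locpoly_at l.

(* C-linearity, for V a subspace of U *)
Definition linear_on (U : lmodType C) (V : set U) (L : V -> C^o) :=
  forall (a : C) (f g k : V), \val k = a *: \val f + \val g ->
    L k = a * L f + L g.

Definition admissible : set (locpoly -> C^o) :=
  [set mu | linear_on mu /\ exists (M : R) (l1 : int),
    forall (i : 'I_m) (a : S) (l : int) (j : nat) (f : locpoly),
      block i a -> l0 <= l -> l1 <= l -> (j <= h)%N ->
      \val f = chi i a l j ->
      cabs (mu f) <= M * pirad (l * (j%:Z - h%:Z))].

(* The difference quotient of order n on B_i. The points t_1, ..., t_{n+1} are
   the coordinates of v 0, ..., v n; [v \o lift k] omits v k. *)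
Fixpoint Phi (i : 'I_m) (n : nat) (f : S -> C^o) : ('I_n.+1 -> S) -> C :=
  match n with
  | 0 => fun v => f (v ord0)
  | n'.+1 => fun v =>
      let k0 : 'I_n'.+2 := ord0 in
      let k1 : 'I_n'.+2 := lift ord0 ord0 in
      (Phi i f (v \o lift k1) - Phi i f (v \o lift k0))
        / kC C (tco i (v k0) - tco i (v k1))
  end.

Definition in_block (i : 'I_m) (n : nat) : set ('I_n.+1 -> S) :=
  [set v | forall k, block i (v k)].
Arguments in_block : clear implicits.

Definition continuous_block (i : 'I_m) (n : nat) (g : ('I_n.+1 -> S) -> C) :=
  forall v, in_block i n v -> forall e, 0 < e -> exists2 d, 0 < d &
    forall w, in_block i n w ->
      (forall k, kabs (tco i (w k) - tco i (v k)) < d) -> cabs (g w - g v) < e.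

Definition Phi_extension (i : 'I_m) (n : nat) (f : S -> C^o) :
    set (('I_n.+1 -> S) -> C) :=
  [set g | continuous_block i g /\
    forall v, in_block i n v -> injective (tco i \o v) -> g v = Phi i f v].

Definition Phibar (i : 'I_m) (n : nat) (f : S -> C^o) : ('I_n.+1 -> S) -> C :=
  xget (fun=> 0) (Phi_extension i f).

Definition Cspace : set (S -> C^o) :=
  [set f | forall i, @Phi_extension i h f !=set0].

(* The suprema are those of continuous functions on compact sets. *)
Definition Cnorm (f : S -> C^o) : R :=
  \big[Num.max/0]_(i < m) \big[Num.max/0]_(j < h.+1)
    sup [set cabs (@Phibar i j f v) | v in in_block i j].

Definition banach (U : lmodType C) (V : set U) (N : U -> R) :=
  [/\ submod_closed (mem V),
      forall f, V f -> 0 <= N f /\ (N f = 0 -> f = 0),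
      forall a f, V f -> N (a *: f) = cabs a * N f,
      forall f g, V f -> V g -> N (f + g) <= Num.max (N f) (N g) &
      complete_for N V].

Definition Cdual : set (Cspace -> C^o) :=
  [set L | linear_on L /\
    forall (f : Cspace) (e : R), 0 < e -> exists2 d, 0 < d &
      forall g : Cspace, Cnorm (\val g - \val f) < d -> cabs (L g - L f) < e].

End FunctionSpaces.

Arguments locpoly {R F} C S {m} c l0 h.
Arguments admissible {R F} C S {m} c l0 h.
Arguments Cspace {R F} C S {m} c l0 h.
Arguments Cnorm {R F} C S {m} c l0 h.
Arguments Cdual {R F} C S {m} c l0 h.
Arguments banach {R F C U} V N.

Definition restriction (T W : Type) (P V : set T) (PV : P `<=` V) (L : V -> W) :
    P -> W :=
  fun f => L (SigSub (mem_set (PV (\val f) (set_valP f)))).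

(* Main.v *)
(** The divided differences of f extend continuously to Phibar_n f, the limits of
    Phi_n f along tuples of distinct points; hence the recursion, the symmetry
    and the Leibniz rule for the product by t - t(a) pass to Phibar_n f.
    Let taylor_N f be the sum, over the balls B of radius r = |pi|^(l0+N), of
    the Taylor polynomial of degree h of f at a centre of B, restricted to B.
    If Phibar_h f oscillates by at most e on tuples inside such balls, then
    |Phibar_n (f - taylor_N f)| <= e r^(h-n) for n <= h: inside a ball by
    descending induction on n, since Phibar_n (f - taylor_N f) vanishes at the
    centre and is Lipschitz with constant sup |Phibar_(n+1)|; and elsewhere
    because the recursion can divide by a difference larger than r.  With
    e -> 0 (uniform continuity) this gives the density of P^(h) in C^h(S); with
    e = |f|_h it bounds the coefficients of taylor_(N+1) f - taylor_N f, so
    that an admissible mu satisfies |mu(taylor_N f)| <= K |f|_h and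
    f |-> lim mu(taylor_N f) is the required extension. *)

Require Import Defs.
From mathcomp Require Import all_boot all_order all_algebra.
From mathcomp Require Import zify ring lra.
From mathcomp Require Import boolp classical_sets functions reals topology.

Set Implicit Arguments.
Unset Strict Implicit.
Unset Printing Implicit Defensive.

Import Order.TTheory GRing.Theory Num.Theory.
Local Open Scope classical_set_scope.
Local Open Scope ring_scope.

(** * Absolute values *)

(** The obstacle is the diagonal. On tuples with repeated points [Phi] divides by 0, so its
    identities hold on distinct tuples only, while the Taylor coefficients at a are values of the
    extension at (a, ..., a). Limits there are unique because the balls have no isolated points, and
    the recursion is carried over with its denominator cleared. A second gap: C^h asks for an
    extension of order h alone, whereas the norm and the Taylor sums use every order up to h, so the
    lower extensions must be constructed. In the duality the exponents cancel: a coefficient of size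
    r^(h-j) meets a value of mu of size r^(j-h), so each term is bounded independently of r, and the
    ultrametric inequality lets the number of terms grow at no cost. *)

Section Valuation.
Variables (R : realType) (F : finFieldType).
Implicit Types x y : laurent F.

Local Notation pirad := (pirad R F).
Local Notation kabs := (@kabs R F).

Lemma pirad0 : pirad 0 = 1.
Proof. by rewrite piradE oppr0 expr0z. Qed.

Lemma piradD l l' : pirad (l + l') = pirad l * pirad l'.
Proof. by rewrite !piradE opprD expfzDr // gt_eqF // card_gt0r. Qed.

Lemma piradN l : pirad (- l) = (pirad l)^-1.
Proof. by rewrite /Defs.pirad -invr_expz. Qed.

Lemma pirad_leE l l' : (pirad l <= pirad l') = (l' <= l).
Proof.
by rewrite !piradE ler_eXz2l ?lerN2 // (ltr_nat R 1) card_finNzRing_gt1.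
Qed.

Lemma pirad_lt e : 0 < e -> exists N : nat, pirad N%:Z < e.
Proof.
move=> e0; have [N eN] : exists N : nat, e^-1 < N%:R.
  by exists (Num.bound e^-1); rewrite archi_boundP // invr_ge0 ltW.
exists N; rewrite piradE -invr_expz -[_ ^ _]/(#|F|%:R ^+ N).
rewrite invf_plt ?posrE ?exprn_gt0 ?card_gt0r //; apply: lt_trans eN _.
by rewrite -natrX ltr_nat ltn_expl // card_finNzRing_gt1.
Qed.

Lemma kabs1 : kabs 1 = 1.
Proof.
rewrite -pirad0; apply: kabs_lord.
by split; [rewrite laurent_coef1 eqxx oner_eq0|exact: lbound_monom].
Qed.

Lemma kabsN x : kabs (- x) = kabs x.
Proof.
have N1 : kabs (-1) = 1.
  have : (kabs (-1)) ^+ 2 = 1 by rewrite expr2 -kabsM mulrNN mulr1 kabs1.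
  by move/eqP; rewrite sqrf_eq1 => /orP[/eqP//|/eqP e'];
    have := kabs_ge0 R (- 1 : laurent F); lra.
by rewrite -mulN1r kabsM N1 mul1r.
Qed.

Lemma kabsC x y : kabs (x - y) = kabs (y - x).
Proof. by rewrite -opprB kabsN. Qed.

Lemma kabsB_trans z x y r :
  kabs (x - z) <= r -> kabs (z - y) <= r -> kabs (x - y) <= r.
Proof.
move=> xz zy; rewrite -(subrK z x) -addrA.
by apply: le_trans (kabsD _ _ _) _; rewrite ge_max xz.
Qed.

Lemma kabsV x : kabs x^-1 = (kabs x)^-1.
Proof.
have [->|x0] := eqVneq x 0; first by rewrite invr0 kabs0 invr0.
have k0 : kabs x != 0 by apply: contraNneq x0 => /kabs_eq0 ->.
by apply: (mulfI k0); rewrite -kabsM !mulfV // kabs1.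
Qed.

Lemma kabs_lbound x l : kabs x <= pirad l <-> Defs.lbound x l.
Proof.
split=> [|/lbound_kabs->//].
have [->//|/lord_exists[n xn]] := eqVneq x 0.
rewrite (kabs_lord R xn) pirad_leE => ln k kl.
by apply: xn.2; exact: lt_le_trans ln.
Qed.

Lemma kabs_monom1 l : kabs (monom 1 l) = pirad l.
Proof.
by apply: kabs_lord; split; [rewrite /= eqxx oner_eq0|exact: lbound_monom].
Qed.

Fact glue_bound x (d : int -> F) (l : int) :
  exists m : int, forall n, n < m -> (if n < l then x n else d n) = 0.
Proof.
have [a xa] := lcoefP x; exists (Num.min a l) => n.
by rewrite lt_min => /andP[na ->]; exact: xa.
Qed.

(** Coefficients from index [l] on are prescribed without leaving the ball of radius |pi|^l around
    [x]; this yields limits of nested balls and the centres of the Taylor sums. *)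
Definition glue x d l := Laurent (glue_bound x d l).

Lemma glueE x d l n : glue x d l n = if n < l then x n else d n.
Proof. by []. Qed.

Lemma kabs_glue x d l : kabs (glue x d l - x) <= pirad l.
Proof.
by apply/kabs_lbound => n nl; rewrite laurent_coefD laurent_coefN glueE nl subrr.
Qed.

End Valuation.

Section CinftyAbs.
Variables (R : realType) (F : finFieldType) (C : Cinfty R F).
Local Notation cabs := (@cabs R F C).
Implicit Types x y z : C.

Lemma cabs_ge0 x : 0 <= cabs x. Proof. by case: (cabs_nonarch C). Qed.
Lemma cabs_eq0 x : cabs x = 0 <-> x = 0. Proof. by case: (cabs_nonarch C). Qed.
Lemma cabsM : {morph cabs : x y / x * y}. Proof. by case: (cabs_nonarch C). Qed.
Lemma cabsD x y : cabs (x + y) <= Num.max (cabs x) (cabs y).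
Proof. by case: (cabs_nonarch C). Qed.

Lemma cabs0 : cabs 0 = 0. Proof. exact/cabs_eq0. Qed.

Lemma cabs_kC (t : laurent F) : cabs (kC C t) = kabs R t.
Proof. exact: cabs_extends. Qed.

Lemma kCB (s t : laurent F) : kC C (s - t) = kC C s - kC C t.
Proof. by rewrite /kC !rmorphB. Qed.

Lemma cabs1 : cabs 1 = 1.
Proof.
have : cabs 1 * cabs 1 = cabs 1 by rewrite -cabsM mulr1.
have /eqP c0 : cabs 1 != 0 by apply/eqP => /cabs_eq0 /eqP; rewrite oner_eq0.
by move=> /eqP; rewrite -subr_eq0 -[X in _ - X]mulr1 -mulrBr mulf_eq0 subr_eq0
  => /orP[/eqP//|/eqP].
Qed.

Lemma cabsN x : cabs (- x) = cabs x.
Proof.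
have N1 : cabs (-1) = 1.
  have : (cabs (-1)) ^+ 2 = 1 by rewrite expr2 -cabsM mulrNN mulr1 cabs1.
  by move/eqP; rewrite sqrf_eq1 => /orP[/eqP//|/eqP e'];
    have := cabs_ge0 (- 1); lra.
by rewrite -mulN1r cabsM N1 mul1r.
Qed.

Lemma cabsC x y : cabs (x - y) = cabs (y - x).
Proof. by rewrite -opprB cabsN. Qed.

Lemma cabsV x : cabs x^-1 = (cabs x)^-1.
Proof.
have [->|x0] := eqVneq x 0; first by rewrite invr0 cabs0 invr0.
have k0 : cabs x != 0 by apply: contraNneq x0 => /cabs_eq0 ->.
by apply: (mulfI k0); rewrite -cabsM !mulfV // cabs1.
Qed.

Lemma cabsD_le x y r : cabs x <= r -> cabs y <= r -> cabs (x + y) <= r.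
Proof. by move=> xr yr; apply: le_trans (cabsD _ _) _; rewrite ge_max xr. Qed.

Lemma cabsD_lt x y r : cabs x < r -> cabs y < r -> cabs (x + y) < r.
Proof. by move=> xr yr; apply: le_lt_trans (cabsD _ _) _; rewrite gt_max xr. Qed.

Lemma cabsB_le x y r : cabs x <= r -> cabs y <= r -> cabs (x - y) <= r.
Proof. by move=> xr yr; apply: cabsD_le; rewrite ?cabsN. Qed.

Lemma cabsB_lt z x y r : cabs (x - z) < r -> cabs (y - z) < r -> cabs (x - y) < r.
Proof.
by move=> xr yr; rewrite -(subrK z x) -addrA; apply: cabsD_lt; rewrite // cabsC.
Qed.

Lemma cabs_sum (I : Type) (s : seq I) (P : pred I) (f : I -> C) r : 0 <= r ->
  (forall k, P k -> cabs (f k) <= r) -> cabs (\sum_(k <- s | P k) f k) <= r.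
Proof.
move=> r0 fr; apply: (big_ind (fun x => cabs x <= r)) => //; first by rewrite cabs0.
by move=> x y; exact: cabsD_le.
Qed.

Lemma cabs_lt0 x : (forall e, 0 < e -> cabs x < e) -> x = 0.
Proof.
move=> xe; apply/cabs_eq0/eqP; rewrite eq_le cabs_ge0 andbT leNgt.
by apply/negP => /xe; rewrite ltxx.
Qed.

Lemma cabs_lt_eq x y : (forall e, 0 < e -> cabs (x - y) < e) -> x = y.
Proof. by move=> /cabs_lt0 /eqP; rewrite subr_eq0 => /eqP. Qed.

End CinftyAbs.

(** * Coordinates on the balls of the decomposition *)

Section Blocks.
Variables (R : realType) (F : finFieldType) (S : set (P1 R F)).
Variables (m : nat) (c : 'I_m -> P1 R F) (l0 : int).
Hypothesis S_balls : ball_decomposition S c l0.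
Implicit Types x y : S.

Local Notation pirad := (pirad R F).
Local Notation kabs := (@kabs R F).
Local Notation block := (@block R F S m c l0).
Local Notation tco := (@tco R F S m c l0).

Lemma block_cover x : exists i, block i x.
Proof.
have Sc p : S p -> exists i, pball (c i) l0 p.
  by rewrite S_balls.1 => -[i _ pi]; exists i.
exact: Sc (set_valP x).
Qed.

Lemma block_disjoint i i' x : block i x -> block i' x -> i = i'.
Proof. by move=> xi xi'; apply: (S_balls.2) => //; exists (\val x). Qed.

Lemma block_exists i (p : P1 R F) : pball (c i) l0 p ->
  exists2 x : S, block i x & \val x = p.
Proof.
move=> pi; have pS : p \in S by apply/mem_set; rewrite S_balls.1; exists i.
by exists (SigSub pS).
Qed.

Section OneBlock.
Variable i : 'I_m.

Lemma tco_fin a x : c i = Some a -> tco i x = odflt 0 (\val x).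
Proof.
move=> ca; rewrite /Defs.tco /Defs.coord ca ifF //.
by apply/negbTE/negP => /set_mem.
Qed.

Lemma tco_inf x : c i = None -> tco i x = oapp (fun z => z^-1) 0 (\val x).
Proof.
by move=> ca; rewrite /Defs.tco /Defs.coord ca; rewrite ifT //; exact/mem_set.
Qed.

(** At infinity, inversion turns |x| >= |pi|^(-l0) into |1/x| <= |pi|^l0, so in its coordinate every
    block lies in one ball of radius |pi|^l0. *)
Lemma tco_bound x y : block i x -> block i y ->
  kabs (tco i x - tco i y) <= pirad l0.
Proof.
rewrite /Defs.block; case ci: (c i) => [a|].
  rewrite !(tco_fin _ ci).
  case: (\val x) (\val y) => [x'|] [y'|] //= xa ya.
  by apply: (kabsB_trans xa); rewrite kabsC.
rewrite !(tco_inf _ ci) => xo yo.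
have inv_le (z : P1 R F) : pball None l0 z ->
    kabs (oapp (fun z => z^-1) 0 z) <= pirad l0.
  case: z => [z|] /= zl; last by rewrite kabs0 ltW // pirad_gt0.
  by rewrite kabsV invf_ple ?posrE ?pirad_gt0 -?piradN //;
    apply: lt_le_trans zl; exact: pirad_gt0.
apply: (@kabsB_trans _ _ 0); rewrite ?subr0 ?sub0r ?kabsN; exact: inv_le.
Qed.

(** Together with [tco_bound]: in its coordinate a block is a whole ball, so points can be
    constructed from their coordinates. *)
Lemma tco_surj x (s : laurent F) : block i x -> kabs (s - tco i x) <= pirad l0 ->
  exists2 y, block i y & tco i y = s.
Proof.
move=> bx sx; have [[a ci]|ci] : (exists a, c i = Some a) \/ c i = None.
- by case: (c i) => [a|]; [left; exists a|right].
- have sa : pball (c i) l0 (Some s : P1 R F).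
    move: bx sx; rewrite /Defs.block (tco_fin _ ci) ci.
    by case: (\val x) => //= x' xa sx; exact: kabsB_trans sx xa.
  have [y b_y ys] := block_exists sa; exists y => //.
  by rewrite (tco_fin _ ci) ys.
have sl : kabs s <= pirad l0.
  have [z bz zo] : exists2 z : S, block i z & \val z = None by
    apply: block_exists; rewrite ci.
  rewrite -[s]subr0; apply: (kabsB_trans sx).
  by have := tco_bound bx bz; rewrite (tco_inf z ci) zo.
(* The coordinate 0 belongs to the point at infinity, every other one to the finite point 1/s. *)
have [s0|s0] := eqVneq s 0.
  have [z bz zo] : exists2 z : S, block i z & \val z = None by
    apply: block_exists; rewrite ci.
  by exists z => //; rewrite (tco_inf z ci) zo s0.
have sa : pball (c i) l0 (Some s^-1 : P1 R F).
  rewrite ci /= kabsV piradN lef_pV2 ?posrE ?pirad_gt0 //.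
  by rewrite lt_neqAle kabs_ge0 andbT eq_sym; apply: contraNneq s0 => /kabs_eq0 ->.
have [y b_y ys] := block_exists sa; exists y => //.
by rewrite (tco_inf _ ci) ys /= invrK.
Qed.

Lemma block_nonempty : exists x, block i x.
Proof.
have : pball (c i) l0 (c i).
  by case: (c i) => [a|] //=; rewrite subrr kabs0 ltW // pirad_gt0.
by move=> /block_exists[x bx _]; exists x.
Qed.

(* the points of coordinate t(x) + pi^l, t(x) + pi^(l+1), ... are distinct *)
Lemma fresh_point x (l : int) (s : seq (laurent F)) : block i x ->
  exists y, [/\ block i y, kabs (tco i y - tco i x) <= pirad l & tco i y \notin s].
Proof.
move=> bx; pose L := Num.max l l0.
pose p (j : nat) : laurent F := tco i x + monom 1 (L + j%:Z).
have p_inj : injective p.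
  move=> j j' /addrI /(congr1 kabs); rewrite !kabs_monom1 => /eqP.
  by rewrite eq_le !pirad_leE => /andP[]; lia.
have [j _ js] : exists2 j, (j < (size s).+1)%N & p j \notin s.
  apply: contrapT => nex.
  have /uniq_leq_size H : uniq [seq p j | j <- iota 0 (size s).+1].
    by rewrite map_inj_uniq ?iota_uniq.
  have : {subset [seq p j | j <- iota 0 (size s).+1] <= s}.
    move=> z /mapP[j]; rewrite mem_iota add0n => js ->.
    by apply/negPn/negP => js'; apply: nex; exists j.
  by move=> /H; rewrite size_map size_iota ltnn.
have pL : kabs (p j - tco i x) <= pirad L.
  by rewrite addrAC subrr add0r kabs_monom1 pirad_leE; lia.
have [y b_y yj] : exists2 y, block i y & tco i y = p j.
  apply: tco_surj bx _; apply: le_trans pL _.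
  by rewrite pirad_leE le_max lexx orbT.
exists y; split; rewrite ?yj //; apply: le_trans pL _.
by rewrite pirad_leE le_max lexx.
Qed.

End OneBlock.
End Blocks.
(** * Limits along tuples of distinct points *)

Section Tuples.
Variable T : Type.

Definition vcons n (x : T) (u : 'I_n -> T) : 'I_n.+1 -> T :=
  fun k => oapp u x (unlift ord0 k).

Lemma vcons0 n x (u : 'I_n -> T) : vcons x u ord0 = x.
Proof. by rewrite /vcons unlift_none. Qed.

Lemma vconsS n x (u : 'I_n -> T) j : vcons x u (lift ord0 j) = u j.
Proof. by rewrite /vcons liftK. Qed.

Lemma vcons_lift0 n x (u : 'I_n -> T) : vcons x u \o lift ord0 = u.
Proof. by apply/funext => j /=; rewrite vconsS. Qed.

Lemma vcons_lift1 n x y (u : 'I_n -> T) :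
  vcons x (vcons y u) \o lift (lift ord0 ord0) = vcons x u.
Proof.
apply/funext => j /=; case: (unliftP ord0 j) => [j' ->|->].
  have -> : lift (lift ord0 ord0) (lift ord0 j') = lift ord0 (lift ord0 j').
    by apply: val_inj.
  by rewrite !vconsS.
have -> : lift (lift ord0 ord0) (ord0 : 'I_n.+1) = ord0 by apply: val_inj.
by rewrite !vcons0.
Qed.

(** The recursion only touches the first two entries; this brings entry [k] within its reach. *)
Definition front n (v : 'I_n.+1 -> T) k := vcons (v k) (v \o lift k).

Lemma front_comp n (k : 'I_n.+1) : exists2 g : 'I_n.+1 -> 'I_n.+1,
  injective g & forall v : 'I_n.+1 -> T, front v k = v \o g.
Proof.
exists (fun x => oapp (lift k) k (unlift ord0 x)) => [x y|v].
  case: (unliftP ord0 x) => [x' ->|->]; case: (unliftP ord0 y) => [y' ->|->];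
    rewrite ?liftK ?unlift_none //=.
  - by move=> /lift_inj ->.
  - by move=> /eqP; rewrite eq_sym (negbTE (neq_lift _ _)).
  - by move=> /eqP; rewrite (negbTE (neq_lift _ _)).
by apply/funext => x; rewrite /front /vcons /=; case: (unlift ord0 x).
Qed.

End Tuples.

Section Limits.
Variables (R : realType) (F : finFieldType) (C : Cinfty R F).
Variables (S : set (P1 R F)) (m : nat) (c : 'I_m -> P1 R F) (l0 : int).
Hypothesis S_balls : ball_decomposition S c l0.
Variable i : 'I_m.

Local Notation pirad := (pirad R F).
Local Notation kabs := (@kabs R F).
Local Notation cabs := (@cabs R F C).
Local Notation t := (@tco R F S m c l0 i).
Local Notation inB := (@in_block R F S m c l0 i _).

Definition distinct n (v : 'I_n.+1 -> S) := inB v /\ injective (t \o v).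

Definition close (l : int) n (w v : 'I_n.+1 -> S) :=
  forall k, kabs (t (w k) - t (v k)) <= pirad l.

(** Tuples with repeated coordinates are left out because [Phi] divides by 0 there; [v] itself may
    be such a tuple. *)
Definition lim_at n (phi : ('I_n.+1 -> S) -> C) (v : 'I_n.+1 -> S) (y : C) :=
  forall e, 0 < e ->
    exists l, forall w, distinct w -> close l w v -> cabs (phi w - y) < e.

Lemma close_refl l n (v : 'I_n.+1 -> S) : close l v v.
Proof. by move=> k; rewrite subrr kabs0 ltW // pirad_gt0. Qed.

Lemma close_sym l n (v w : 'I_n.+1 -> S) : close l v w -> close l w v.
Proof. by move=> vw k; rewrite kabsC. Qed.

Lemma close_trans l n (u v w : 'I_n.+1 -> S) :
  close l u v -> close l v w -> close l u w.
Proof. by move=> uv vw k; exact: kabsB_trans (uv k) (vw k). Qed.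

Lemma close_le l l' n (v w : 'I_n.+1 -> S) : l' <= l -> close l v w -> close l' v w.
Proof. by move=> ll vw k; apply: le_trans (vw k) _; rewrite pirad_leE. Qed.

(** By [fresh_point] the entries can be moved one after another to new coordinates. This density of
    distinct tuples makes limits at diagonal points unique. *)
Lemma distinct_avoid n (v : 'I_n.+1 -> S) l (s : seq (laurent F)) : inB v ->
  exists w, [/\ distinct w, close l w v & forall k, t (w k) \notin s].
Proof.
move=> bv.
have H p : (p <= n.+1)%N -> exists w : 'I_n.+1 -> S, [/\ inB w, close l w v,
    forall k : 'I_n.+1, (k < p)%N -> t (w k) \notin s &
    forall k j : 'I_n.+1, (j < k < p)%N -> t (w k) != t (w j)]; last first.
  have [w [bw wv ws winj]] := H n.+1 (leqnn _).
  exists w; split => // [|k]; last exact/ws.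
  split => // k j /= e; apply/eqP; rewrite -(inj_eq val_inj) eqn_leq.
  by apply/andP; split; rewrite leqNgt; apply/negP => kj;
    [have := winj k j|have := winj j k]; rewrite kj ltn_ord e eqxx => /(_ isT).
elim: p => [_|p IH pn].
  by exists v; split => //; [exact: close_refl|move=> k j; rewrite ltn0 andbF].
have [w [bw wv ws winj]] := IH (ltnW pn).
pose kp := Ordinal pn.
have [y [b_y yv ys]] := fresh_point S_balls l (s ++ [seq t (w j) | j : 'I_n.+1]) (bv kp).
move: ys; rewrite mem_cat negb_or => /andP[ys yw].
have {}yw j : t y != t (w j).
  by apply: contra yw => /eqP ->; apply: (map_f (fun j => t (w j))); rewrite mem_enum.
exists (fun k : 'I_n.+1 => if val k == p then y else w k); split.
- by move=> k; case: ifP.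
- by move=> k; case: eqP => // kpE; rewrite (_ : k = kp) //; exact: val_inj.
- move=> k; rewrite ltnS leq_eqVlt; case: eqP => //= _; exact: ws.
- move=> k j /andP[jk]; rewrite ltnS leq_eqVlt; case: eqP => [kpE _|_ /= kp'].
    by rewrite ltn_eqF // -kpE.
  by rewrite ltn_eqF ?(ltn_trans jk) // winj // jk.
Qed.

Lemma lim_uniq n (phi : ('I_n.+1 -> S) -> C) v y z : inB v ->
  lim_at phi v y -> lim_at phi v z -> y = z.
Proof.
move=> bv py pz; apply: cabs_lt_eq => e e0.
have [[l1 l1P] [l2 l2P]] := (py e e0, pz e e0).
have [w [dw wv _]] := distinct_avoid (Num.max l1 l2) [::] bv.
by apply: (@cabsB_lt _ _ _ (phi w)); rewrite cabsC; [apply: l1P|apply: l2P];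
  rewrite //; apply: close_le wv; rewrite le_max lexx ?orbT.
Qed.

Lemma lim_near n l (phi psi : ('I_n.+1 -> S) -> C) v y :
  (forall w, distinct w -> close l w v -> phi w = psi w) ->
  lim_at phi v y -> lim_at psi v y.
Proof.
move=> e_ py e /py[l' H]; exists (Num.max l l') => w dw wv.
rewrite -e_ //; last by apply: close_le wv; rewrite le_max lexx.
by apply: H => //; apply: close_le wv; rewrite le_max lexx orbT.
Qed.

Lemma lim_eq n (phi psi : ('I_n.+1 -> S) -> C) v y :
  (forall w, distinct w -> phi w = psi w) ->
  lim_at phi v y -> lim_at psi v y.
Proof. by move=> e_; apply: (@lim_near _ 0) => w dw _; exact: e_. Qed.

Lemma lim_cst n v y : lim_at (fun _ : 'I_n.+1 -> S => y) v y.
Proof. by move=> e e0; exists 0 => w _ _; rewrite subrr cabs0. Qed.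

Lemma limD n (phi psi : ('I_n.+1 -> S) -> C) v y z :
  lim_at phi v y -> lim_at psi v z -> lim_at (fun w => phi w + psi w) v (y + z).
Proof.
move=> py pz e e0; have [[l1 l1P] [l2 l2P]] := (py e e0, pz e e0).
exists (Num.max l1 l2) => w dw wv.
rewrite opprD addrACA; apply: cabsD_lt; [apply: l1P|apply: l2P] => //;
  by apply: close_le wv; rewrite le_max lexx ?orbT.
Qed.

Lemma lim_bounded n (phi : ('I_n.+1 -> S) -> C) v y : lim_at phi v y ->
  exists l, forall w, distinct w -> close l w v -> cabs (phi w) <= Num.max 1 (cabs y).
Proof.
move=> /(_ 1 ltr01)[l H]; exists l => w dw wv.
rewrite -(subrK y (phi w)); apply: le_trans (cabsD _ _) _.
by rewrite ge_max !le_max lexx orbT andbT ltW // H.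
Qed.

Lemma limM n (phi psi : ('I_n.+1 -> S) -> C) v y z :
  lim_at phi v y -> lim_at psi v z -> lim_at (fun w => phi w * psi w) v (y * z).
Proof.
move=> py pz e e0; have [l0' bd] := lim_bounded py.
pose M := Num.max 1 (cabs y); pose N := Num.max 1 (cabs z).
have M0 : 0 < M by rewrite lt_max ltr01.
have N0 : 0 < N by rewrite lt_max ltr01.
have [l1 l1P] := py _ (divr_gt0 e0 N0).
have [l2 l2P] := pz _ (divr_gt0 e0 M0).
exists (Num.max l0' (Num.max l1 l2)) => w dw wv.
have {bd} bd : cabs (phi w) <= M.
  by apply: bd => //; apply: close_le wv; rewrite le_max lexx.
have {}l1P : cabs (phi w - y) < e / N.
  by apply: l1P => //; apply: close_le wv; rewrite !le_max lexx orbT.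
have {}l2P : cabs (psi w - z) < e / M.
  by apply: l2P => //; apply: close_le wv; rewrite !le_max lexx !orbT.
have -> : phi w * psi w - y * z = phi w * (psi w - z) + (phi w - y) * z.
  by rewrite mulrBr mulrBl addrA subrK.
apply: cabsD_lt; rewrite cabsM.
  apply: le_lt_trans (_ : M * cabs (psi w - z) < e).
    by rewrite ler_wpM2r ?cabs_ge0.
  by rewrite mulrC -ltr_pdivlMr.
apply: le_lt_trans (_ : cabs (phi w - y) * N < e).
  by rewrite ler_wpM2l ?cabs_ge0 // le_max lexx orbT.
by rewrite -ltr_pdivlMr.
Qed.

Lemma limV n (phi : ('I_n.+1 -> S) -> C) v y : y != 0 ->
  lim_at phi v y -> lim_at (fun w => (phi w)^-1) v y^-1.
Proof.
move=> y0 py e e0.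
have cy : 0 < cabs y.
  by rewrite lt_neqAle cabs_ge0 andbT eq_sym; apply: contraNneq y0 => /cabs_eq0 ->.
(* Below |y| the ultrametric inequality forces |phi w| = |y|; the second bound pays for the
   denominator |y|^2 in the difference of the inverses. *)
have e1 : 0 < Num.min (cabs y) (e * cabs y ^+ 2).
  by rewrite lt_min cy mulr_gt0 // exprn_gt0.
have [l H] := py _ e1; exists l => w dw wv.
have := H w dw wv; rewrite lt_min => /andP[pyw pyw'].
have cw : cabs (phi w) = cabs y.
  apply/eqP; rewrite eq_le; apply/andP; split.
    by rewrite -(subrK y (phi w)); apply: cabsD_le => //; exact: ltW.
  rewrite leNgt; apply/negP => lt_wy.
  have : cabs y < cabs y by rewrite -{1}(subKr (phi w) y);
    apply: cabsD_lt => //; rewrite cabsN.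
  by rewrite ltxx.
have w0 : phi w != 0 by apply: contraTneq cy => w0; rewrite -cw w0 cabs0 ltxx.
have -> : (phi w)^-1 - y^-1 = - (phi w - y) / (y * phi w).
  by field; rewrite y0 w0.
by rewrite cabsM cabsN cabsV cabsM cw -expr2 ltr_pdivrMr // exprn_gt0.
Qed.

Lemma limZ n a (phi : ('I_n.+1 -> S) -> C) v y :
  lim_at phi v y -> lim_at (fun w => a * phi w) v (a * y).
Proof. by apply: limM; exact: lim_cst. Qed.

Lemma limB n (phi psi : ('I_n.+1 -> S) -> C) v y z :
  lim_at phi v y -> lim_at psi v z -> lim_at (fun w => phi w - psi w) v (y - z).
Proof.
move=> py /(limZ (-1)); rewrite mulN1r => /(limD py).
by apply: lim_eq => w _; rewrite mulN1r.
Qed.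

Lemma lim_tco n (v : 'I_n.+1 -> S) k :
  lim_at (fun w => kC C (t (w k))) v (kC C (t (v k))).
Proof.
move=> e /(pirad_lt F)[N Ne]; exists N%:Z => w _ wv.
by rewrite -kCB cabs_kC; exact: le_lt_trans (wv k) Ne.
Qed.

Lemma lim_comp n p (kappa : ('I_n.+1 -> S) -> ('I_p.+1 -> S)) l phi v y :
  (forall w, distinct w -> close l w v -> distinct (kappa w)) ->
  (forall l' w, close l' w v -> close l' (kappa w) (kappa v)) ->
  lim_at phi (kappa v) y -> lim_at (phi \o kappa) v y.
Proof.
move=> kd kc py e /py[l' H]; exists (Num.max l l') => w dw wv; apply: H.
  by apply: kd => //; apply: close_le wv; rewrite le_max lexx.
by apply: kc; apply: close_le wv; rewrite le_max lexx orbT.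
Qed.

Lemma lim_sub n p (g : 'I_p.+1 -> 'I_n.+1) phi v y : injective g ->
  lim_at phi (v \o g) y -> lim_at (fun w => phi (w \o g)) v y.
Proof.
move=> g_inj; apply: (@lim_comp _ _ (fun w => w \o g) 0) => [w [bw winj] _|l' w wv k].
  by split=> [k|k j /= /winj/g_inj //]; exact: bw.
exact: wv.
Qed.

Lemma lim_le n (phi : ('I_n.+1 -> S) -> C) v y l r : inB v ->
  (forall w, distinct w -> close l w v -> cabs (phi w) <= r) ->
  lim_at phi v y -> cabs y <= r.
Proof.
move=> bv pr py; rewrite leNgt; apply/negP => ry.
have y0 : 0 < cabs y.
  have [w [dw wv _]] := distinct_avoid l [::] bv.
  by apply: le_lt_trans ry; apply: le_trans (pr w dw wv); exact: cabs_ge0.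
have [l' H] := py _ y0.
have [w [dw wv _]] := distinct_avoid (Num.max l l') [::] bv.
have : cabs y < cabs y.
  rewrite -{1}(subKr (phi w) y); apply: cabsD_lt.
    by apply: le_lt_trans ry; apply: pr => //; apply: close_le wv; rewrite le_max lexx.
  by rewrite cabsN; apply: H => //; apply: close_le wv; rewrite le_max lexx orbT.
by rewrite ltxx.
Qed.

End Limits.
(** * Difference quotients and their continuous extensions *)

Section DifferenceQuotients.
Variables (R : realType) (F : finFieldType) (C : Cinfty R F).
Variables (S : set (P1 R F)) (m : nat) (c : 'I_m -> P1 R F) (l0 : int).
Variable i : 'I_m.

Local Notation t := (@tco R F S m c l0 i).
Local Notation Phi := (@Phi R F C S m c l0 i _).
Implicit Types f g : S -> C^o.

Lemma kC_eq0 (x : laurent F) : (kC C x == 0) = (x == 0).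
Proof. by rewrite /kC !fmorph_eq0. Qed.

Lemma kC_tcoB_neq0 n (v : 'I_n.+1 -> S) j k : injective (t \o v) -> j != k ->
  kC C (t (v j)) - kC C (t (v k)) != 0.
Proof.
by move=> vinj; apply: contraNneq => e; apply/eqP/vinj/eqP;
  rewrite -subr_eq0 -kC_eq0 kCB e eqxx.
Qed.

Lemma Phi_rec n f (v : 'I_n.+2 -> S) :
  Phi f v = (Phi f (v \o lift (lift ord0 ord0)) - Phi f (v \o lift ord0))
    / (kC C (t (v ord0)) - kC C (t (v (lift ord0 ord0)))).
Proof. by rewrite /= kCB. Qed.

(** The closed form is symmetric in the points, which the recursion hides; [Phi_front] rests on
    it. *)
Lemma PhiE n f (v : 'I_n.+1 -> S) : injective (t \o v) ->
  Phi f v = \sum_k (f (v k) : C) *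
    \prod_(j | j != k) (kC C (t (v k)) - kC C (t (v j)))^-1.
Proof.
elim: n v => [|n IH] v vinj.
  rewrite big_ord1 big1 ?mulr1 // => j.
  by rewrite (ord1 j) eqxx.
(* Leaving out the point [p] multiplies the k-th summand by t_k - t_p, which also kills the summand
   k = p; both terms of the recursion become sums over the same indices. *)
have omit p : Phi f (v \o lift p) = \sum_k (f (v k) : C) *
    \prod_(j | j != k) (kC C (t (v k)) - kC C (t (v j)))^-1 *
    (kC C (t (v k)) - kC C (t (v p))).
  rewrite IH; last by move=> j k /vinj /lift_inj.
  rewrite (bigD1_ord p) //= subrr mulr0 add0r; apply: eq_bigr => k _.
  rewrite (bigD1_ord p) ?neq_lift //=.
  under [in RHS]eq_bigl do rewrite (inj_eq lift_inj).
  rewrite -mulrA; congr (_ * _); rewrite mulrC mulVKf //.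
  by apply: kC_tcoB_neq0 => //; rewrite eq_sym neq_lift.
rewrite Phi_rec !omit -sumrB; apply: canLR (mulfK _) _.
  by apply: kC_tcoB_neq0.
rewrite mulr_suml; apply: eq_bigr => k _.
by rewrite -mulrBr; congr (_ * _); ring.
Qed.

Lemma Phi_front n f (v : 'I_n.+1 -> S) k : injective (t \o v) ->
  Phi f (front v k) = Phi f v.
Proof.
move=> vinj; have [g g_inj ->] := front_comp S k.
rewrite !PhiE //; last by move=> x y /vinj/g_inj.
rewrite [RHS](reindex_inj g_inj); apply: eq_bigr => j _.
rewrite [in RHS](reindex_inj g_inj); congr (_ * _).
by apply: eq_bigl => j'; rewrite (inj_eq g_inj).
Qed.

Lemma Phi_ext n f g (v : 'I_n.+1 -> S) : (forall k, f (v k) = g (v k)) ->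
  Phi f v = Phi g v.
Proof.
elim: n v => [|n IH] v fg; first exact: fg.
by rewrite !Phi_rec !(IH (_ \o _)) // => k; exact: fg.
Qed.

Lemma Phi_linear n a f g (v : 'I_n.+1 -> S) :
  Phi (a *: f + g) v = a * Phi f v + Phi g v.
Proof.
elim: n v => [//|n IH] v.
by rewrite !Phi_rec !IH; ring.
Qed.

Lemma Phi_zero n (v : 'I_n.+1 -> S) : Phi 0 v = 0.
Proof. by elim: n v => [//|n IH] v; rewrite Phi_rec !IH subrr mul0r. Qed.

Lemma Phi_const n f (v : 'I_n.+2 -> S) :
  (forall j k, f (v j) = f (v k)) -> Phi f v = 0.
Proof.
elim: n v => [|n IH] v fv; rewrite Phi_rec.
  by rewrite /= (fv _ (lift ord0 ord0)) subrr mul0r.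
by rewrite !IH ?subrr ?mul0r // => j k; exact: fv.
Qed.

(** The Leibniz rule has two terms only, since the quotients of order at least 2 of a polynomial of
    degree 1 vanish. It drives the inductions on the degree [j] of [chi]. *)
Lemma Phi_mul_tco n f a (v : 'I_n.+2 -> S) : injective (t \o v) ->
  Phi (fun x => kC C (t x - t a) * (f x : C)) v =
  kC C (t (v ord0) - t a) * Phi f v + Phi f (v \o lift ord0).
Proof.
have base (w : 'I_2 -> S) : injective (t \o w) ->
    Phi (fun x => kC C (t x - t a) * (f x : C)) w =
    kC C (t (w ord0) - t a) * Phi f w + Phi f (w \o lift ord0).
  move=> winj; rewrite !Phi_rec /= !kCB.
  have -> : lift (lift ord0 ord0) ord0 = ord0 :> 'I_2 by apply: val_inj.
  have := @kC_tcoB_neq0 _ w ord0 (lift ord0 ord0) winj isT.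
  by move=> ?; field.
elim: n v => [|n IH] v vinj; first exact: base.
rewrite Phi_rec !IH; try by move=> j k /vinj /lift_inj.
set A := Phi f (v \o lift _); set B := Phi f (v \o lift ord0).
have -> : (v \o lift (lift ord0 ord0)) ord0 = v ord0 by congr (v _); apply: val_inj.
have -> : (v \o lift (lift ord0 ord0)) \o lift ord0 = (v \o lift ord0) \o lift ord0.
  by apply/funext => j /=; congr (v _); apply: val_inj.
rewrite [Phi f v]Phi_rec -/A -/B /= !kCB.
have := @kC_tcoB_neq0 _ v ord0 (lift ord0 ord0) vinj isT.
by move=> ?; field.
Qed.

End DifferenceQuotients.
Section ExtendedQuotients.
Variables (R : realType) (F : finFieldType) (C : Cinfty R F).
Variables (S : set (P1 R F)) (m : nat) (c : 'I_m -> P1 R F) (l0 : int).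
Hypothesis S_balls : ball_decomposition S c l0.
Variable i : 'I_m.

Local Notation pirad := (pirad R F).
Local Notation kabs := (@kabs R F).
Local Notation cabs := (@cabs R F C).
Local Notation t := (@tco R F S m c l0 i).
Local Notation inB := (@in_block R F S m c l0 i _).
Local Notation Phi := (@Phi R F C S m c l0 i _).
Local Notation Phibar := (@Phibar R F C S m c l0 i _).
Local Notation Phi_extension := (@Phi_extension R F C S m c l0 i _).
Local Notation distinct := (@distinct R F S m c l0 i _).
Local Notation close := (@close R F S m c l0 i).
Local Notation lim_tco := (@lim_tco R F C S m c l0 i _).
Local Notation lim_cst := (@lim_cst R F C S m c l0 i _).
Local Notation lim_at := (@lim_at R F C S m c l0 i _).
Implicit Types f : S -> C^o.

(** A limit at each tuple separately is easier to construct than a continuous extension; [isCP]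
    shows that they amount to the same. *)
Definition isC n f := forall v : 'I_n.+1 -> S, inB v ->
  exists y, lim_at (Phi f) v y.

Lemma lim_at_distinct n (phi : ('I_n.+1 -> S) -> C) v y :
  distinct v -> lim_at phi v y -> phi v = y.
Proof.
by move=> dv py; apply: cabs_lt_eq => e /py[l]; apply => //; exact: close_refl.
Qed.

Lemma Phi_extension_lim n f g (v : 'I_n.+1 -> S) :
  Phi_extension f g -> inB v -> lim_at (Phi f) v (g v).
Proof.
move=> [gc gP] bv e /(gc v bv)[d d0 dP]; have [N Nd] := pirad_lt F d0.
exists N%:Z => w [bw winj] wv; rewrite -gP //; apply: dP => // k.
exact: le_lt_trans (wv k) Nd.
Qed.

(** Pointwise limits are automatically continuous: near [v] the values on distinct tuples are within
    e/2 of [g v], and [g w], a limit of such values, keeps the non-strict bound. *)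
Lemma isCP n f : isC n f <-> @Defs.Phi_extension R F C S m c l0 i n f !=set0.
Proof.
split=> [fC|[g gP] v bv]; last by exists (g v); exact: Phi_extension_lim.
pose g (v : 'I_n.+1 -> S) : C := xget 0 [set y | lim_at (Phi f) v y].
have gl v : inB v -> lim_at (Phi f) v (g v).
  by move=> /fC[y yP]; rewrite /g; case: xgetP => [z _ //|/(_ y)].
exists g; split=> [v bv e e0|v bv vinj]; last first.
  by rewrite -(lim_at_distinct _ (gl v bv)).
have e2 : 0 < e / 2 by rewrite divr_gt0.
have [l lP] := gl v bv _ e2; exists (pirad l); first exact: pirad_gt0.
move=> w bw wv; apply: le_lt_trans (_ : e / 2 < e); last by lra.
have : lim_at (fun u => Phi f u - g v) w (g w - g v).
  by apply: limB; [exact: gl|exact: lim_cst].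
apply: (lim_le S_balls (l := l)) => // u du uw; apply/ltW/lP => //.
by apply: close_trans uw _ => k; apply/ltW/wv.
Qed.

Lemma Phibar_lim n f (v : 'I_n.+1 -> S) : isC n f -> inB v ->
  lim_at (Phi f) v (Phibar f v).
Proof.
move=> /isCP[g gP] bv; apply: Phi_extension_lim => //.
exact: xgetI gP.
Qed.

Lemma Phibar_uniq n f (v : 'I_n.+1 -> S) y : isC n f -> inB v ->
  lim_at (Phi f) v y -> Phibar f v = y.
Proof. by move=> fC bv; apply: (lim_uniq S_balls) => //; exact: Phibar_lim. Qed.

Lemma Phibar_distinct n f (v : 'I_n.+1 -> S) : isC n f -> distinct v ->
  Phibar f v = Phi f v.
Proof. by move=> fC dv; rewrite (lim_at_distinct dv (Phibar_lim fC dv.1)). Qed.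

Lemma distinct0 (v : 'I_1 -> S) : inB v -> distinct v.
Proof. by move=> bv; split => // j k _; rewrite !ord1. Qed.

Lemma Phibar0 f (v : 'I_1 -> S) : isC 0 f -> inB v -> Phibar f v = f (v ord0).
Proof. by move=> fC bv; rewrite Phibar_distinct //; exact: distinct0. Qed.

Lemma Phibar_le n f r : isC n f -> (forall v : 'I_n.+1 -> S, distinct v ->
  cabs (Phi f v) <= r) -> forall v : 'I_n.+1 -> S, inB v -> cabs (Phibar f v) <= r.
Proof.
move=> fC fr v bv; apply: (lim_le S_balls (l := 0) bv) (Phibar_lim fC bv).
by move=> w dw _; exact: fr.
Qed.

Lemma in_block_comp n p (h : 'I_p.+1 -> 'I_n.+1) (v : 'I_n.+1 -> S) :
  inB v -> inB (v \o h).
Proof. by move=> bv k; exact: bv. Qed.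

Lemma in_block_vcons n x (v : 'I_n.+1 -> S) :
  block c l0 i x -> inB v -> inB (vcons x v).
Proof.
move=> bx bv k; case: (unliftP ord0 k) => [k' ->|->]; rewrite ?vconsS ?vcons0 //.
Qed.

Lemma inj_vcons n x (v : 'I_n -> S) : injective (t \o v) ->
  (forall k, t (v k) != t x) -> injective (t \o vcons x v).
Proof.
move=> vinj vx k k'.
case: (unliftP ord0 k) => [j ->|->]; case: (unliftP ord0 k') => [j' ->|->] //=.
- by rewrite !vconsS => /vinj ->.
- by rewrite vconsS vcons0 => e; have := vx j; rewrite e eqxx.
- by rewrite vconsS vcons0 => e; have := vx j'; rewrite -e eqxx.
Qed.

(** The denominator is cleared so that the identity survives when the first two points of [v]
    coincide. *)
Lemma lim_rec n f (v : 'I_n.+2 -> S) y z w : inB v ->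
  lim_at (Phi f) v y -> lim_at (Phi f) (v \o lift (lift ord0 ord0)) z ->
  lim_at (Phi f) (v \o lift ord0) w ->
  y * (kC C (t (v ord0)) - kC C (t (v (lift ord0 ord0)))) = z - w.
Proof.
move=> bv fy fz fw.
have A := limM fy (limB (lim_tco v ord0) (lim_tco v (lift ord0 ord0))).
have B := limB (lim_sub (@lift_inj _ _) fz) (lim_sub (@lift_inj _ _) fw).
apply: (lim_uniq S_balls bv A); apply: lim_eq B => u [bu uinj].
by rewrite Phi_rec divfK //; apply: (kC_tcoB_neq0 C uinj).
Qed.

Lemma Phibar_rec n f (v : 'I_n.+2 -> S) : isC n f -> isC n.+1 f -> inB v ->
  Phibar f v * (kC C (t (v ord0)) - kC C (t (v (lift ord0 ord0)))) =
  Phibar f (v \o lift (lift ord0 ord0)) - Phibar f (v \o lift ord0).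
Proof.
move=> fC fC1 bv; apply: lim_rec (bv) _ _ _; apply: Phibar_lim => //;
  exact: in_block_comp.
Qed.

Lemma in_block_front n (v : 'I_n.+1 -> S) k : inB v -> inB (front v k).
Proof. by have [g _ ->] := front_comp S k; exact: in_block_comp. Qed.

Lemma Phibar_front n f (v : 'I_n.+1 -> S) k : isC n f -> inB v ->
  Phibar f (front v k) = Phibar f v.
Proof.
move=> fC bv; have [g g_inj gE] := front_comp S k.
have bf := in_block_front k bv.
apply: (lim_uniq S_balls bv) (Phibar_lim fC bv).
have := Phibar_lim fC bf; rewrite {1}gE => /(lim_sub g_inj).
by apply: lim_eq => w [bw winj]; rewrite -gE Phi_front.
Qed.

(** Symmetry brings entry [k] to the head, where the recursion compares the two tuples. *)
Lemma Phi_change n f (u u' : 'I_n.+1 -> S) k : u \o lift k = u' \o lift k ->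
  injective (t \o u) -> injective (t \o u') -> t (u k) != t (u' k) ->
  Phi f u - Phi f u' = (kC C (t (u k)) - kC C (t (u' k))) *
    Phi f (vcons (u k) (vcons (u' k) (u \o lift k))).
Proof.
move=> uu' uinj u'inj uk; rewrite Phi_rec vcons_lift0 vcons_lift1 vcons0 vconsS vcons0.
rewrite mulrC divfK; last by rewrite -kCB kC_eq0 subr_eq0.
rewrite -(Phi_front f k uinj) -(Phi_front f k u'inj) /front -uu'.
by [].
Qed.

Lemma Phibar_change n f (u u' : 'I_n.+1 -> S) k : isC n f -> isC n.+1 f ->
  inB u -> inB u' -> u \o lift k = u' \o lift k ->
  Phibar f u - Phibar f u' = (kC C (t (u k)) - kC C (t (u' k))) *
    Phibar f (vcons (u k) (vcons (u' k) (u \o lift k))).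
Proof.
move=> fC fC1 bu bu' uu'.
rewrite -(Phibar_front k fC bu) -(Phibar_front k fC bu') /front -uu'.
have bb : inB (vcons (u k) (vcons (u' k) (u \o lift k))).
  by apply: in_block_vcons => //; rewrite uu'; exact: in_block_front.
have := Phibar_rec fC fC1 bb; rewrite vcons_lift0 vcons_lift1 vcons0 vconsS vcons0.
by rewrite mulrC => ->.
Qed.

(* For a tuple y of points off v, Phi_n f(w) is obtained from the constant
   Phi_n f(y) by replacing one entry at a time; each step is a value of
   Phi_(n+1) f on a tuple which stays distinct as w -> v. *)
Lemma isC_pred n f : isC n.+1 f -> isC n f.
Proof.
move=> fC v bv.
have [y [[b_y yinj] _ yv]] :=
  distinct_avoid S_balls l0 [seq t (v j) | j : 'I_n.+1] bv.
have {}yv j k : t (v j) != t (y k).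
  apply: contra (yv k) => /eqP <-; apply: (map_f (fun j => t (v j))).
  by rewrite mem_enum.
have /choice[Nf NfP] (p : 'I_n.+1 * 'I_n.+1) :
    exists N : nat, pirad N%:Z < kabs (t (v p.1) - t (y p.2)).
  apply: pirad_lt; rewrite lt_neqAle kabs_ge0 andbT eq_sym.
  by apply: contraNneq (yv p.1 p.2) => /kabs_eq0 /eqP; rewrite subr_eq0.
(* Within radius |pi|^L of [v] no entry of [w] meets an entry of [y], so tuples mixed from both stay
   distinct. *)
pose L : nat := \max_p Nf p.
have wy w j k : close L%:Z w v -> t (w j) != t (y k).
  move=> wv; apply/eqP => e; have := wv j; rewrite e kabsC leNgt => /negP; apply.
  apply: le_lt_trans (NfP (j, k)); rewrite pirad_leE lez_nat.
  exact: (leq_bigmax (j, k)).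
pose mix k (w : 'I_n.+1 -> S) (j : 'I_n.+1) := if (j < k)%N then y j else w j.
have mixinj k w : injective (t \o w) -> close L%:Z w v -> injective (t \o mix k w).
  move=> winj wv j j' /=; rewrite /mix; case: ifP => _; case: ifP => _.
  - exact: yinj.
  - by move=> /esym e; have := wy w j' j wv; rewrite e eqxx.
  - by move=> e; have := wy w j j' wv; rewrite e eqxx.
  - exact: winj.
have mixB k w : inB w -> inB (mix k w).
  by move=> bw j; rewrite /mix; case: ifP => _; [exact: b_y|exact: bw].
pose kap (k : 'I_n.+1) w : 'I_n.+2 -> S :=
  vcons (w k) (vcons (y k) (mix k w \o lift k)).
have mixk (k : 'I_n.+1) w : mix k w \o lift k = mix k.+1 w \o lift k.
  apply/funext => j; rewrite /mix /= ltnS [in RHS]leq_eqVlt.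
  by rewrite eq_sym (negbTE (neq_bump _ _)).
have kapB k w : inB w -> inB (kap k w).
  move=> bw; apply: in_block_vcons; first exact: bw.
  rewrite mixk; have -> : y k = mix k.+1 w k by rewrite /mix ltnSn.
  exact: in_block_front (mixB _ _ bw).
(* [p] counts the entries taken from [w]: none for p = 0, where the function is constant, all for p
   = n + 1, where it is [Phi f]. *)
suff H p : (p <= n.+1)%N ->
    exists z, lim_at (fun w => Phi f (mix (n.+1 - p)%N w)) v z.
  have [z zP] := H n.+1 (leqnn _); exists z; apply: lim_eq zP => w _.
  by rewrite subnn.
elim: p => [_|p IH pn].
  exists (Phi f y); apply: lim_eq (lim_cst _ _) => w _; rewrite subn0.
  by congr Phi; apply/funext => j; rewrite /mix ltn_ord.
have [z zP] := IH (ltnW pn).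
have kn : (n.+1 - p.+1 < n.+1)%N by lia.
pose k := Ordinal kn.
have kE : (n.+1 - p = (val k).+1)%N by rewrite /=; lia.
have [z' z'P] := fC _ (kapB k v bv).
exists (z + (kC C (t (v k)) - kC C (t (y k))) * z').
have kd w : distinct w -> close L%:Z w v -> distinct (kap k w).
  move=> [bw winj] wv; split; first exact: kapB.
  apply: inj_vcons => [|j]; first apply: inj_vcons => [|j].
  - by move=> j j' /(mixinj _ _ winj wv)/lift_inj.
  - rewrite mixk; have -> : y k = mix k.+1 w k by rewrite /mix ltnSn.
    apply/eqP => /(mixinj _ _ winj wv)/eqP.
    by rewrite eq_sym (negbTE (neq_lift _ _)).
  - case: (unliftP ord0 j) => [j' ->|->]; rewrite ?vconsS ?vcons0.
      have -> : w k = mix k w k by rewrite /mix ltnn.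
      apply/eqP => /(mixinj _ _ winj wv)/eqP.
      by rewrite eq_sym (negbTE (neq_lift _ _)).
    by rewrite eq_sym wy.
have kc l' w : close l' w v -> close l' (kap k w) (kap k v).
  have refl0 x : kabs (t x - t x) <= pirad l' by rewrite subrr kabs0 ltW ?pirad_gt0.
  move=> wv j; rewrite /kap; case: (unliftP ord0 j) => [j' ->|->].
    rewrite !vconsS; case: (unliftP ord0 j') => [j2 ->|->].
      by rewrite !vconsS /mix /=; case: ifP.
    by rewrite !vcons0.
  by rewrite !vcons0.
have := limD zP (limM (limB (lim_tco v k) (lim_cst v (kC C (t (y k)))))
  (lim_comp kd kc z'P)).
apply: (@lim_near _ _ _ _ _ _ _ _ _ L%:Z) => w [bw winj] wv; rewrite kE.
have mk : mix k w k = w k by rewrite /mix ltnn.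
have mk1 : mix k.+1 w k = y k by rewrite /mix ltnSn.
have := @Phi_change _ f _ _ _ (mixk k w) (mixinj _ _ winj wv) (mixinj _ _ winj wv).
by rewrite mk mk1 => /(_ (wy _ _ _ wv)) /eqP; rewrite subr_eq addrC => /eqP.
Qed.

Lemma isC_le n p f : (p <= n)%N -> isC n f -> isC p f.
Proof.
elim: n => [|n IH]; first by rewrite leqn0 => /eqP ->.
by rewrite leq_eqVlt ltnS => /orP[/eqP->//|/IH H /isC_pred].
Qed.

Lemma isC_linear n a f g : isC n f -> isC n g -> isC n (a *: f + g).
Proof.
move=> fC gC v bv; exists (a * Phibar f v + Phibar g v).
have := limD (limZ a (Phibar_lim fC bv)) (Phibar_lim gC bv).
by apply: lim_eq => w _; rewrite Phi_linear.
Qed.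

Lemma Phibar_linear n a f g (v : 'I_n.+1 -> S) : isC n f -> isC n g -> inB v ->
  Phibar (a *: f + g) v = a * Phibar f v + Phibar g v.
Proof.
move=> fC gC bv; apply: Phibar_uniq => //; first exact: isC_linear.
have := limD (limZ a (Phibar_lim fC bv)) (Phibar_lim gC bv).
by apply: lim_eq => w _; rewrite Phi_linear.
Qed.

Lemma isC_zero n : isC n 0.
Proof.
by move=> v _; exists 0; apply: lim_eq (lim_cst _ _) => w _; rewrite Phi_zero.
Qed.

Lemma Phibar_zero n (v : 'I_n.+1 -> S) : inB v -> Phibar 0 v = 0.
Proof.
move=> bv; apply: Phibar_uniq => //; first exact: isC_zero.
by apply: lim_eq (lim_cst _ _) => w _; rewrite Phi_zero.
Qed.

Lemma lim_mul_tco n f a (v : 'I_n.+2 -> S) y z : lim_at (Phi f) v y ->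
  lim_at (Phi f) (v \o lift ord0) z ->
  lim_at (Phi (fun x => kC C (t x - t a) * (f x : C))) v
    (kC C (t (v ord0) - t a) * y + z).
Proof.
move=> fy fz.
have := limD (limM (limB (lim_tco v ord0) (lim_cst v (kC C (t a)))) fy)
  (lim_sub (@lift_inj _ _) fz).
rewrite kCB; apply: lim_eq => w [_ winj].
by rewrite Phi_mul_tco // kCB.
Qed.

Lemma isC_mul_tco n f a : isC n f ->
  isC n (fun x => kC C (t x - t a) * (f x : C)).
Proof.
case: n => [|n] fC v bv.
  exists (kC C (t (v ord0) - t a) * Phibar f v).
  have := limM (limB (lim_tco v ord0) (lim_cst v (kC C (t a)))) (Phibar_lim fC bv).
  by rewrite kCB; apply: lim_eq => w _; rewrite /= kCB.
have [y fy] := fC v bv.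
have [z fz] := isC_pred fC (in_block_comp (lift ord0) bv).
by exists (kC C (t (v ord0) - t a) * y + z); exact: lim_mul_tco.
Qed.

Lemma Phibar_mul_tco n f a (v : 'I_n.+2 -> S) : isC n.+1 f -> inB v ->
  Phibar (fun x => kC C (t x - t a) * (f x : C)) v =
  kC C (t (v ord0) - t a) * Phibar f v + Phibar f (v \o lift ord0).
Proof.
move=> fC bv; apply: Phibar_uniq => //; first exact: isC_mul_tco.
apply: lim_mul_tco; apply: Phibar_lim => //; [exact: isC_pred|exact: in_block_comp].
Qed.

End ExtendedQuotients.

(** * Compactness of the products of balls *)

Section Compactness.
Variables (R : realType) (F : finFieldType) (C : Cinfty R F).
Variables (S : set (P1 R F)) (m : nat) (c : 'I_m -> P1 R F) (l0 : int).
Hypothesis S_balls : ball_decomposition S c l0.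
Variable i : 'I_m.

Local Notation pirad := (pirad R F).
Local Notation kabs := (@kabs R F).
Local Notation cabs := (@cabs R F C).
Local Notation t := (@tco R F S m c l0 i).
Local Notation inB := (@in_block R F S m c l0 i _).
Local Notation Phibar := (@Phibar R F C S m c l0 i _).
Local Notation close := (@close R F S m c l0 i).
Local Notation isC := (@isC R F C S m c l0 i).

(** The finite-subcover property on the ball of radius |pi|^l around [v], for the cover whose ball
    at each centre s has radius |pi|^(L s). *)
Definition covered n (L : ('I_n.+1 -> S) -> int) v l :=
  exists (I : finType) (s : I -> 'I_n.+1 -> S), (forall k, inB (s k)) /\
    forall w, inB w -> close l w v -> exists k, close (L (s k)) w (s k).

(** Fixing the coefficients of index [l] of all coordinates cuts the ball into finitely many balls
    of radius |pi|^(l+1), because [F] is finite. *)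
Lemma covered_step n (L : ('I_n.+1 -> S) -> int) v l : inB v ->
  (forall v', inB v' -> close l v' v -> covered L v' (l + 1)) -> covered L v l.
Proof.
move=> bv cov.
have /choice[p pP] (d : {ffun 'I_n.+1 -> F}) :
    exists p : {I : finType & I -> 'I_n.+1 -> S},
      (forall k, inB (tagged p k)) /\
      forall w, inB w -> close l w v -> (forall k, t (w k) l = d k) ->
        exists k, close (L (tagged p k)) w (tagged p k).
  have [[v' [bv' v'v v'd]]|nex] := pselect (exists v', [/\ inB v', close l v' v &
      forall k, t (v' k) l = d k]); last first.
    exists (existT (fun I : finType => I -> 'I_n.+1 -> S) void
      (fun q : void => match q with end)).
    split=> [[]|w bw wv wd]; exfalso; apply: nex; exists w; split => //.
  have [I [s [sB sP]]] := cov _ bv' v'v.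
  exists (existT (fun I : finType => I -> 'I_n.+1 -> S) I s); split => // w bw wv wd.
  apply: sP => // k; apply/kabs_lbound => q.
  rewrite ltzD1 le_eqVlt laurent_coefD laurent_coefN => /orP[/eqP->|ql].
    by rewrite wd v'd subrr.
  have /kabs_lbound/(_ q ql) := close_trans wv (close_sym v'v) k.
  by rewrite laurent_coefD laurent_coefN.
exists {d : {ffun 'I_n.+1 -> F} & tag (p d)}, (fun q => tagged (p (tag q)) (tagged q)).
split=> [[d k] /=|w bw wv]; first exact: (pP d).1.
have [] := (pP [ffun k => t (w k) l]).2 w bw wv; first by move=> k; rewrite ffunE.
by move=> k kP; exists (Tagged (fun d => tag (p d)) k).
Qed.

(* If no finite subfamily covered the product of balls, some smaller and
   smaller product of balls would not be covered either, and the limit of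
   their centres gives a contradiction. *)
Lemma tuples_compact n (L : ('I_n.+1 -> S) -> int) v : inB v -> covered L v l0.
Proof.
move=> bv; apply: contrapT => ncov.
have /choice[nxt nxtP] (p : ('I_n.+1 -> S) * int) : exists v', inB p.1 ->
    ~ covered L p.1 p.2 ->
    [/\ inB v', close p.2 v' p.1 & ~ covered L v' (p.2 + 1)].
  have [[bp nc]|np] := pselect (inB p.1 /\ ~ covered L p.1 p.2); last first.
    by exists v => bp nc; exfalso; apply: np.
  have [[v' v'P]|nex] := pselect (exists v',
      [/\ inB v', close p.2 v' p.1 & ~ covered L v' (p.2 + 1)]); first by exists v'.
  exfalso; apply: nc; apply: covered_step => // v' bv' v'p; apply: contrapT => nc'.
  by apply: nex; exists v'.
pose fix u (N : nat) := if N is N'.+1 then nxt (u N', l0 + N'%:Z) else v.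
have uP N : inB (u N) /\ ~ covered L (u N) (l0 + N%:Z).
  elim: N => [|N [bN cN]]; first by rewrite addr0.
  have [bN1 _ cN1] := nxtP (u N, l0 + N%:Z) bN cN; split => //.
  by have -> : l0 + N.+1%:Z = l0 + N%:Z + 1 by lia.
have u1 N : close (l0 + N%:Z) (u N.+1) (u N).
  by have [bN cN] := uP N; have [] := nxtP (u N, l0 + N%:Z) bN cN.
have uc p q : close (l0 + p%:Z) (u (p + q)%N) (u p).
  elim: q => [|q IH]; first by rewrite addn0; exact: close_refl.
  by rewrite addnS; apply: close_trans IH; apply: close_le (u1 _); lia.
have lim k : exists x, block c l0 i x /\ forall N : nat,
    kabs (t x - t (u N k)) <= pirad (l0 + N%:Z).
  (* The coefficient of index l0 + r is the same in all [u N] with N > r, hence is read off at r +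
     1; below [l0] all points of the block agree. *)
  pose z := glue (t (v k)) (fun n => t (u `|n - l0|.+1 k) n) l0.
  have [x bx xz] := tco_surj S_balls (bv k) (kabs_glue R _ _ _ : kabs (z - t (v k)) <= _).
  exists x; split=> // N; apply/kabs_lbound => r rN.
  rewrite xz laurent_coefD laurent_coefN glueE; case: ltP => rl0.
    have /kabs_lbound/(_ r rl0) := tco_bound (bv k) ((uP N).1 k).
    by rewrite laurent_coefD laurent_coefN.
  pose p := absz (r - l0); have pN : (p.+1 <= N)%N by lia.
  have := uc p.+1 (N - p.+1)%N k; rewrite subnKC // kabsC => /kabs_lbound/(_ r).
  by rewrite laurent_coefD laurent_coefN => -> //; lia.
have /choice[x xP] := lim.
have xu N : close (l0 + N%:Z) x (u N) by move=> k; exact: (xP k).2.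
have bx : inB x by move=> k; exact: (xP k).1.
(* At this index the ball is no larger than the one prescribed at the limit [x], so the single
   centre [x] covers it. *)
pose N := absz (L x - l0); apply: (uP N).2.
exists unit, (fun=> x); split => // w bw wu; exists tt.
apply: (@close_le _ _ _ _ _ _ _ (l0 + N%:Z)); first by rewrite /N; lia.
exact: close_trans wu (close_sym (xu N)).
Qed.

Lemma Phibar_cont n f (v : 'I_n.+1 -> S) e : isC n f -> inB v -> 0 < e ->
  exists l, forall w, inB w -> close l w v -> cabs (Phibar f w - Phibar f v) < e.
Proof.
move=> /(isCP S_balls)[g gP] bv e0.
have [cont _] := xgetI (fun=> 0) gP.
have [d d0 dP] := cont v bv e e0; have [N Nd] := pirad_lt F d0.
exists N%:Z => w bw wv; apply: dP => // k; exact: le_lt_trans (wv k) Nd.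
Qed.

Lemma Phibar_cover n f e : isC n f -> 0 < e ->
  exists (I : finType) (s : I -> 'I_n.+1 -> S) (L : I -> int),
  [/\ forall k, inB (s k),
      forall w, inB w -> exists k, close (L k) w (s k) &
      forall k w, inB w -> close (L k) w (s k) ->
        cabs (Phibar f w - Phibar f (s k)) < e].
Proof.
move=> fC e0; have [x bx] := block_nonempty S_balls i.
have bv : inB (fun _ : 'I_n.+1 => x) by [].
have /choice[L LP] (v : 'I_n.+1 -> S) : exists l, inB v ->
    forall w, inB w -> close l w v -> cabs (Phibar f w - Phibar f v) < e.
  have [b|nb] := pselect (inB v); last by exists 0.
  by have [l lP] := Phibar_cont fC b e0; exists l.
have [I [s [sB sP]]] := tuples_compact L bv.
exists I, s, (L \o s); split => // [w bw|k w bw]; last exact: LP.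
by apply: sP => // k; exact: (tco_bound).
Qed.

Lemma Phibar_bounded n f : isC n f ->
  exists M, forall w : 'I_n.+1 -> S, inB w -> cabs (Phibar f w) <= M.
Proof.
move=> fC; have [I [s [L [sB sP LP]]]] := Phibar_cover fC ltr01.
exists (\big[Num.max/1]_k cabs (Phibar f (s k))) => w bw.
have [k kP] := sP w bw; rewrite -(subrK (Phibar f (s k)) (Phibar f w)).
apply: cabsD_le; last exact: le_bigmax.
by apply: le_trans (ltW (LP k w bw kP)) _; exact: bigmax_ge_id.
Qed.

(** Tuples closer than each of the finitely many radii of the cover lie in the same ball of it, by
    the ultrametric inequality. *)
Lemma Phibar_unif_cont n f e : isC n f -> 0 < e ->
  exists N : nat, forall w w' : 'I_n.+1 -> S, inB w -> inB w' ->
    close N%:Z w w' -> cabs (Phibar f w - Phibar f w') < e.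
Proof.
move=> fC e0; have [I [s [L [sB sP LP]]]] := Phibar_cover fC e0.
exists (\max_k `|L k|)%N => w w' bw bw' ww'.
have [k kP] := sP w bw.
apply: (@cabsB_lt _ _ _ (Phibar f (s k))); apply: LP => //.
apply: close_trans kP; apply: close_sym; apply: close_le ww'.
apply: le_trans (lez_abs _) _.
by rewrite lez_nat; exact: (leq_bigmax k).
Qed.

End Compactness.
(** * The Banach space C^h *)

Section Norm.
Variables (R : realType) (F : finFieldType) (C : Cinfty R F).
Variables (S : set (P1 R F)) (m : nat) (c : 'I_m -> P1 R F) (l0 : int) (h : nat).
Hypothesis S_balls : ball_decomposition S c l0.

Local Notation cabs := (@cabs R F C).
Local Notation inB := (@in_block R F S m c l0).
Local Notation Phi := (@Phi R F C S m c l0).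
Local Notation Phibar := (@Phibar R F C S m c l0).
Local Notation distinct := (@distinct R F S m c l0).
Local Notation isC := (@isC R F C S m c l0).
Local Notation CS := (Cspace C S c l0 h).
Local Notation N := (Cnorm C S c l0 h).
Implicit Types f g : S -> C^o.

Lemma CspaceP f : CS f <-> forall i, isC i h f.
Proof. by split=> fC i; apply/(isCP S_balls i); exact: fC. Qed.

Lemma Cspace_isC i j f : CS f -> (j <= h)%N -> isC i j f.
Proof. by move=> /CspaceP/(_ i) fC jh; exact: isC_le fC. Qed.
Arguments Cspace_isC i {j f}.

(** A supremum in [R] is an upper bound only for bounded sets, so compactness enters here through
    [Phibar_bounded]. *)
Lemma Phibar_le_Cnorm i j f (v : 'I_j.+1 -> S) : CS f -> (j <= h)%N ->
  inB i v -> cabs (Phibar i f v) <= N f.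
Proof.
move=> fC jh bv; have [M MP] := Phibar_bounded S_balls (Cspace_isC i fC jh).
pose G k (j : 'I_h.+1) := sup [set cabs (Phibar k f w) | w in @in_block R F S m c l0 k j].
apply: (le_trans _ (le_bigmax 0 (fun k => \big[Num.max/0]_j G k j) i)).
apply: (le_trans _ (le_bigmax 0 (G i) (Ordinal (jh : (j < h.+1)%N)))).
by apply: ub_le_sup; [exists M => _ [w bw <-]; exact: MP|exists v].
Qed.

Lemma Cnorm_ge0 f : 0 <= N f. Proof. exact: bigmax_ge_id. Qed.

Lemma Cnorm_le f r : 0 <= r -> (forall i j (v : 'I_j.+1 -> S), (j <= h)%N ->
  inB i v -> cabs (Phibar i f v) <= r) -> N f <= r.
Proof.
move=> r0 fr; apply: bigmax_le => // i _; apply: bigmax_le => // -[j jh] _ /=.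
apply: ge_sup => [|_ [v bv <-]]; last exact: fr.
have [x bx] := block_nonempty S_balls i.
by exists (cabs (Phibar i f (fun _ : 'I_j.+1 => x))), (fun=> x).
Qed.

Lemma Phi_le_Cnorm i j f (v : 'I_j.+1 -> S) : CS f -> (j <= h)%N ->
  distinct i v -> cabs (Phi i f v) <= N f.
Proof.
move=> fC jh dv; rewrite -(Phibar_distinct S_balls) //; last exact: Cspace_isC.
by apply: Phibar_le_Cnorm => //; exact: dv.1.
Qed.

(** Distinct tuples suffice by density, so norm inequalities can be read off the algebra of
    [Phi]. *)
Lemma Cnorm_le_Phi f r : CS f -> 0 <= r ->
  (forall i j (v : 'I_j.+1 -> S), (j <= h)%N -> distinct i v ->
    cabs (Phi i f v) <= r) -> N f <= r.
Proof.
move=> fC r0 fr; apply: Cnorm_le => // i j v jh bv.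
by apply: (Phibar_le S_balls) => // [|w dw]; [exact: Cspace_isC|exact: fr].
Qed.

Lemma eval_le_Cnorm f x : CS f -> cabs (f x) <= N f.
Proof.
move=> fC; have [i bx] := block_cover S_balls x.
apply: (@Phi_le_Cnorm i 0 f (fun=> x)) => //.
by apply: distinct0.
Qed.

Lemma PhiB i n f g (v : 'I_n.+1 -> S) : Phi i (f - g) v = Phi i f v - Phi i g v.
Proof.
by rewrite -scaleN1r addrC Phi_linear mulN1r addrC.
Qed.

Lemma Cspace_submod : submod_closed (mem CS).
Proof.
split=> [|a f g]; first by rewrite inE; apply/CspaceP => i; exact: isC_zero.
rewrite !inE => /CspaceP fC /CspaceP gC; apply/CspaceP => i; exact: isC_linear.
Qed.

Lemma Cspace_linear a f g : CS f -> CS g -> CS (a *: f + g).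
Proof. by move=> fC gC; apply/set_mem/Cspace_submod.2; rewrite inE. Qed.

Lemma Cspace0 : CS 0.
Proof. by apply/set_mem/Cspace_submod.1. Qed.

Lemma CspaceZ a f : CS f -> CS (a *: f).
Proof.
move=> fC; rewrite -[_ *: _]addr0; apply: Cspace_linear => //; exact: Cspace0.
Qed.

Lemma CspaceB f g : CS f -> CS g -> CS (f - g).
Proof. by move=> fC gC; rewrite -scaleN1r addrC; exact: Cspace_linear. Qed.

Lemma PhibarB i j f g (v : 'I_j.+1 -> S) : CS f -> CS g -> (j <= h)%N ->
  inB i v -> Phibar i (f - g) v = Phibar i f v - Phibar i g v.
Proof.
move=> fC gC jh bv; rewrite -scaleN1r addrC (Phibar_linear S_balls) //.
- by rewrite mulN1r addrC.
- exact: Cspace_isC.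
- exact: Cspace_isC.
Qed.

Lemma CnormZ_le a f : CS f -> N (a *: f) <= cabs a * N f.
Proof.
move=> fC; apply: Cnorm_le_Phi => [||i j v jh dv]; first exact: CspaceZ.
  by rewrite mulr_ge0 ?cabs_ge0 ?Cnorm_ge0.
rewrite -[a *: f]addr0 Phi_linear Phi_zero addr0 cabsM.
by rewrite ler_wpM2l ?cabs_ge0 ?Phi_le_Cnorm.
Qed.

Lemma CnormZ a f : CS f -> N (a *: f) = cabs a * N f.
Proof.
move=> fC; apply/eqP; rewrite eq_le CnormZ_le //=.
have [->|a0] := eqVneq a 0; first by rewrite cabs0 mul0r Cnorm_ge0.
have a1 : 0 < cabs a.
  by rewrite lt_neqAle cabs_ge0 andbT eq_sym; apply: contraNneq a0 => /cabs_eq0 ->.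
have := CnormZ_le a^-1 (CspaceZ a fC).
by rewrite scalerA mulVf // scale1r cabsV ler_pdivlMl.
Qed.

Lemma CnormD f g : CS f -> CS g -> N (f + g) <= Num.max (N f) (N g).
Proof.
move=> fC gC; apply: Cnorm_le_Phi => [||i j v jh dv].
- by rewrite -[f]scale1r; exact: Cspace_linear.
- by rewrite le_max Cnorm_ge0.
rewrite -[f in Phi _ (f + _)]scale1r Phi_linear mul1r.
by apply: cabsD_le; rewrite le_max Phi_le_Cnorm ?orbT.
Qed.

Lemma Phi_cvg i n (u : nat -> S -> C^o) f (v : 'I_n.+1 -> S) :
  (forall x, cvg_for cabs (u^~ x) (f x)) ->
  cvg_for cabs (fun k => Phi i (u k) v) (Phi i f v).
Proof.
move=> uf; elim: n v => [|n IH] v; first exact: uf.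
move=> e e0; pose d := (kC C (tco c l0 i (v ord0)) -
  kC C (tco c l0 i (v (lift ord0 ord0))))^-1 : C.
(* [d] may be 0, as [v] need not be distinct and the inverse of 0 is 0; the summand 1 keeps the
   divisor positive. *)
have d0 : 0 < cabs d + 1 by rewrite ltr_wpDl ?cabs_ge0.
have ed := divr_gt0 e0 d0.
have [n1 H1] := IH (v \o lift (lift ord0 ord0)) _ ed.
have [n2 H2] := IH (v \o lift ord0) _ ed.
exists (maxn n1 n2) => k; rewrite geq_max => /andP[kn1 kn2].
have {H1} := H1 _ kn1; have {H2} := H2 _ kn2.
rewrite !Phi_rec -/d; set A := Phi _ _ _; set A' := Phi _ _ _.
set B := Phi _ _ _; set B' := Phi _ _ _ => AA BB.
have -> : (B - A) * d - (B' - A') * d = ((B - B') - (A - A')) * d by ring.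
rewrite cabsM; apply: le_lt_trans (_ : cabs (B - B' - (A - A')) * (cabs d + 1) < e).
  by rewrite ler_wpM2l ?cabs_ge0 // lerDl.
by rewrite -ltr_pdivlMr //; apply: cabsD_lt; rewrite ?cabsN.
Qed.

Lemma Cspace_complete : complete_for N CS.
Proof.
move=> u uC uN.
have PhiN k p i j (v : 'I_j.+1 -> S) : (j <= h)%N -> distinct i v ->
    cabs (Phi i (u k) v - Phi i (u p) v) <= N (u k - u p).
  by move=> jh dv; rewrite -PhiB; apply: Phi_le_Cnorm => //; exact: CspaceB.
have /choice[f fP] x : exists y : C^o, cvg_for cabs (u^~ x) y.
  have [//||y _ yP] := @Cinf_complete R F C (u^~ x); last by exists y.
  move=> e e0; have [n0 H] := uN e e0; exists n0 => k p kn pn.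
  apply: le_lt_trans (H k p kn pn).
  exact: (@eval_le_Cnorm (u k - u p) x (CspaceB (uC k) (uC p))).
(* The auxiliary index [p] depends on the tuple, the bound on the norm of [u k - u p] does not;
   hence the convergence is uniform. *)
have uf e : 0 < e -> exists n0, forall k, (n0 <= k)%N -> forall i j (v : 'I_j.+1 -> S),
    (j <= h)%N -> distinct i v -> cabs (Phi i (u k) v - Phi i f v) < e.
  move=> e0; have [n0 H] := uN e e0; exists n0 => k kn i j v jh dv.
  have [n1 H1] := Phi_cvg i v fP e0; pose p := maxn n0 n1.
  rewrite -(subrK (Phi i (u p) v) (Phi i (u k) v)) -addrA; apply: cabsD_lt.
    by apply: le_lt_trans (PhiN _ _ _ _ _ jh dv) _; apply: H; rewrite ?leq_maxl.
  by apply: H1; rewrite leq_maxr.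
have fC : CS f.
  apply/CspaceP => i v bv.
  have [//||y _ yP] := @Cinf_complete R F C (fun k => Phibar i (u k) v).
    move=> e e0; have [n0 H] := uN e e0; exists n0 => k p kn pn.
    apply: le_lt_trans (H k p kn pn).
    have uB := CspaceB (uC k) (uC p).
    by rewrite -PhibarB //; exact: Phibar_le_Cnorm.
  (* Exchange of the limits in [k] and [w]: the quotients of one [u k] are close to those of [f]
     uniformly in [w], and their limit at [v] is close to [y]. *)
  exists y => e e0; have [n0 H] := yP e e0; have [n1 H1] := uf e e0.
  pose k := maxn n0 n1.
  have [l lP] := Phibar_lim S_balls (Cspace_isC i (uC k) (leqnn h)) bv e0.
  exists l => w dw wv; apply: (@cabsB_lt _ _ _ (Phibar i (u k) v)); last first.
    by rewrite cabsC; apply: H; rewrite leq_maxl.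
  rewrite -(subrK (Phi i (u k) w) (Phi i f w)) -addrA; apply: cabsD_lt; last exact: lP.
  by rewrite cabsC; apply: H1 => //; rewrite leq_maxr.
exists f => // e e0; have e2 : 0 < e / 2 by rewrite divr_gt0.
have [n0 H] := uf _ e2; exists n0 => k kn.
apply: le_lt_trans (_ : e / 2 < e); last by lra.
apply: Cnorm_le_Phi => [||i j v jh dv]; [exact: CspaceB|exact: ltW|].
by rewrite PhiB; apply/ltW/H.
Qed.

Lemma Cspace_banach : banach CS N.
Proof.
split; [exact: Cspace_submod| |by move=> a f; exact: CnormZ|
  by move=> f g; exact: CnormD|exact: Cspace_complete].
move=> f fC; split=> [|f0]; first exact: Cnorm_ge0.
apply/funext => x; apply/cabs_eq0/eqP.
by rewrite eq_le cabs_ge0 andbT -f0; exact: eval_le_Cnorm.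
Qed.

End Norm.
(** * Estimates on small balls *)

Section LocalEstimates.
Variables (R : realType) (F : finFieldType) (C : Cinfty R F).
Variables (S : set (P1 R F)) (m : nat) (c : 'I_m -> P1 R F) (l0 : int).
Hypothesis S_balls : ball_decomposition S c l0.
Variable i : 'I_m.

Local Notation pirad := (pirad R F).
Local Notation kabs := (@kabs R F).
Local Notation cabs := (@cabs R F C).
Local Notation t := (@tco R F S m c l0 i).
Local Notation inB := (@in_block R F S m c l0 i _).
Local Notation Phi := (@Phi R F C S m c l0 i _).
Local Notation Phibar := (@Phibar R F C S m c l0 i _).
Local Notation Sball := (@Sball R F S m c l0 i).
Local Notation chi := (@chi R F C S m c l0 i).
Local Notation lim_at := (@lim_at R F C S m c l0 i _).
Local Notation isC := (@isC R F C S m c l0 i).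
Implicit Types f g : S -> C^o.

Lemma in_Sball_block n a l (v : 'I_n.+1 -> S) :
  (forall k, Sball a l (v k)) -> inB v.
Proof. by move=> va k; exact: (va k).1. Qed.

Lemma SballE a b l x : Sball a l b -> Sball a l x <-> Sball b l x.
Proof.
move=> [bb ba]; split=> [[bx xa]|[bx xb]]; split => //.
  by apply: (kabsB_trans xa); rewrite kabsC.
exact: kabsB_trans xb ba.
Qed.

Lemma Sball_refl a l : block c l0 i a -> Sball a l a.
Proof. by move=> ba; split => //; rewrite subrr kabs0 ltW ?pirad_gt0. Qed.

Lemma front1 n (v : 'I_n.+2 -> S) (k : 'I_n.+2) : k != ord0 ->
  front v k ord0 = v k /\ front v k (lift ord0 ord0) = v ord0.
Proof.
move=> k0; rewrite /front vcons0 vconsS; split => //=; congr (v _).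
by apply: val_inj; rewrite /= /bump leqn0 (negbTE (k0 : (k : nat) != 0%N)).
Qed.

Lemma one_ball_or_far n l (v : 'I_n.+2 -> S) : inB v ->
  (forall k, Sball (v ord0) l (v k)) \/
  exists k, pirad l < kabs (t (front v k ord0) - t (front v k (lift ord0 ord0))).
Proof.
move=> bv; have [?|/existsNP[k nk]] := pselect (forall k, Sball (v ord0) l (v k)).
  by left.
right; exists k; have k0 : k != ord0.
  by apply/eqP => k0; apply: nk; rewrite k0; exact: Sball_refl.
have [-> ->] := front1 v k0; rewrite ltNge; apply/negP => kl; apply: nk.
by split.
Qed.

(* Either all the points of [v] lie in one ball of radius |pi|^l, or the
   recursion applies to two points at a distance greater than |pi|^l. *)
Lemma Phibar_scaled_bound p l (e : int) r f : 0 <= r -> isC p f ->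
  (forall n (v : 'I_n.+1 -> S), (n <= p)%N -> (forall k, Sball (v ord0) l (v k)) ->
    cabs (Phibar f v) <= r * pirad (l * (e - n%:Z))) ->
  forall n (v : 'I_n.+1 -> S), (n <= p)%N -> inB v ->
    cabs (Phibar f v) <= r * pirad (l * (e - n%:Z)).
Proof.
move=> r0 fC H; elim=> [|n IH] v np bv.
  by apply: H => // k; rewrite (ord1 k); exact: Sball_refl.
have [/H ->//|[k far]] := one_ball_or_far l bv.
have fCn1 : isC n.+1 f by exact: isC_le fC.
have fCn := isC_pred S_balls fCn1.
have bu := in_block_front k bv.
rewrite -(Phibar_front S_balls k fCn1 bv).
have := Phibar_rec S_balls fCn fCn1 bu; move: (front v k) bu far => u bu far.
move/(congr1 cabs); rewrite cabsM -kCB cabs_kC => E.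
have far0 := lt_trans (pirad_gt0 R F l) far.
apply: le_trans (_ : cabs (Phibar f u) *
  (kabs (t (u ord0) - t (u (lift ord0 ord0))) / pirad l) <= _).
  by rewrite ler_peMr ?cabs_ge0 // ler_pdivlMr ?pirad_gt0 // mul1r ltW.
rewrite mulrA E ler_pdivrMr ?pirad_gt0 // -mulrA -piradD.
have -> : l * (e - n.+1%:Z) + l = l * (e - n%:Z).
  by rewrite -{2}[l]mulr1 -mulrDr; congr (_ * _); lia.
by apply: cabsB_le; apply: IH; rewrite ?(ltnW np) //; exact: in_block_comp.
Qed.

(** The same dichotomy: two points at a distance greater than |pi|^l keep the denominator away from
    0 near the tuple, so the limit is a quotient of limits of lower order. *)
Lemma isC_locally l f :
  (forall n (v : 'I_n.+1 -> S), (forall k, Sball (v ord0) l (v k)) ->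
    exists y, lim_at (Phi f) v y) ->
  forall n, isC n f.
Proof.
move=> H; elim=> [|n IH] v bv.
  by apply: H => k; rewrite (ord1 k); exact: Sball_refl.
have [/H//|[k far]] := one_ball_or_far l bv.
have [g g_inj gE] := front_comp S k.
have bu := in_block_front k bv.
suff [y fy] : exists y, lim_at (Phi f) (front v k) y.
  exists y; move: fy; rewrite gE => /(lim_sub g_inj); apply: lim_eq => w [_ winj].
  by rewrite -gE Phi_front.
move: (front v k) bu far => u bu far.
have [y fy] := IH _ (in_block_comp (lift (lift ord0 ord0)) bu).
have [z fz] := IH _ (in_block_comp (lift ord0) bu).
pose d := kC C (t (u ord0)) - kC C (t (u (lift ord0 ord0))).
have d0 : d != 0.
  rewrite /d -kCB kC_eq0; apply: contraTneq far => ->.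
  by rewrite kabs0 -leNgt ltW ?pirad_gt0.
exists ((y - z) / d).
have A := limB (lim_sub (@lift_inj _ _) fy) (lim_sub (@lift_inj _ _) fz).
have B := limV d0 (limB (lim_tco C c l0 i u ord0) (lim_tco C c l0 i u (lift ord0 ord0))).
by apply: lim_eq (limM A B) => w _; rewrite Phi_rec.
Qed.

(** Entries are replaced by [x] one at a time; each step costs a coordinate difference, at most
    |pi|^l, times a value of order n + 1, and by the ultrametric inequality the steps do not add
    up. *)
Lemma Phibar_lipschitz n l r f x : 0 <= r -> isC n.+1 f -> block c l0 i x ->
  (forall u : 'I_n.+2 -> S, (forall k, Sball x l (u k)) -> cabs (Phibar f u) <= r) ->
  forall v : 'I_n.+1 -> S, (forall k, Sball x l (v k)) ->
    cabs (Phibar f v - Phibar f (fun _ : 'I_n.+1 => x)) <= pirad l * r.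
Proof.
move=> r0 fC1 bx H v vx; have fC := isC_pred S_balls fC1.
pose mix p (j : 'I_n.+1) := if (j < p)%N then x else v j.
have mixx p k : Sball x l (mix p k).
  by rewrite /mix; case: ifP => _ //; exact: Sball_refl.
suff Hm p : (p <= n.+1)%N -> cabs (Phibar f v - Phibar f (mix p)) <= pirad l * r.
  have := Hm n.+1 (leqnn _); congr (cabs (_ - Phibar _ _) <= _).
  by apply/funext => j; rewrite /mix ltn_ord.
elim: p => [_|p IH pn].
  have -> : mix 0%N = v by apply/funext.
  by rewrite subrr cabs0 mulr_ge0 ?(ltW (pirad_gt0 _ _ _)).
rewrite -(subrK (Phibar f (mix p)) (Phibar f v)) -addrA.
apply: cabsD_le; first exact: IH (ltnW pn).
pose k := Ordinal pn.
have mk : mix p \o lift k = mix p.+1 \o lift k.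
  apply/funext => j; rewrite /mix /= ltnS [in RHS]leq_eqVlt.
  by rewrite eq_sym (negbTE (neq_bump _ _)).
rewrite (Phibar_change S_balls fC fC1 _ _ mk); try exact: in_Sball_block (mixx _).
rewrite cabsM ler_pM ?cabs_ge0 //.
  rewrite -kCB cabs_kC; apply: (@kabsB_trans _ _ (t x)); first exact: (mixx p k).2.
  by rewrite kabsC; exact: (mixx p.+1 k).2.
apply: H => j; case: (unliftP ord0 j) => [j' ->|->]; last by rewrite vcons0.
rewrite vconsS; case: (unliftP ord0 j') => [j2 ->|->]; last by rewrite vcons0.
rewrite vconsS; exact: mixx.
Qed.

Lemma Phibar_local n l f g (v : 'I_n.+1 -> S) : isC n f -> isC n g -> inB v ->
  (forall k x, Sball (v k) l x -> f x = g x) -> Phibar f v = Phibar g v.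
Proof.
move=> fC gC bv fg; apply: (Phibar_uniq S_balls) => //.
apply: (@lim_near _ _ _ _ _ _ _ _ _ l) (Phibar_lim S_balls gC bv) => w [bw _] wv.
by apply: Phi_ext => k; apply/esym/(fg k); split.
Qed.

Section Chi.
Variables (a : S) (l : int).
Hypothesis ba : block c l0 i a.

Lemma chi_in j x : Sball a l x -> chi a l j x = kC C (t x - t a) ^+ j.
Proof. by move=> xa; rewrite /Defs.chi ifT //; exact/mem_set. Qed.

Lemma chi_out j x : ~ Sball a l x -> chi a l j x = 0.
Proof. by move=> xa; rewrite /Defs.chi ifF //; apply/negbTE/negP => /set_mem. Qed.

Lemma chiS j : chi a l j.+1 = fun x => kC C (t x - t a) * (chi a l j x : C).
Proof.
by apply/funext => x; rewrite /Defs.chi; case: ifP => _; rewrite ?exprS ?mulr0.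
Qed.

Lemma isC_chi n j : isC n (chi a l j).
Proof.
elim: j n => [|j IH] n; last by rewrite chiS; exact: isC_mul_tco.
apply: (isC_locally (l := l)) => {}n v vv.
(* Balls of radius |pi|^l in a block are disjoint or equal, so the indicator [chi a l 0] is constant
   on each. *)
have cst w : inB w -> close c l0 i l w v ->
    forall k, chi a l 0 (w k) = chi a l 0 (v ord0).
  move=> bw wv k; have xa : Sball (v ord0) l (w k).
    by split; [exact: bw|exact: kabsB_trans (wv k) (vv k).2].
  have [va|nva] := pselect (Sball a l (v ord0)).
    by rewrite !chi_in ?expr0 //; apply/(SballE _ va).
  rewrite !chi_out // => wa; apply: nva; apply/(SballE _ wa)/(SballE _ xa).
  exact: vv.
case: n v vv cst => [|n] v vv cst.
  exists (chi a l 0 (v ord0)); apply: (@lim_near _ _ _ _ _ _ _ _ _ l) (lim_cst _ _ _ _ _).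
  by move=> w [bw _] wv; rewrite /= cst.
exists 0; apply: (@lim_near _ _ _ _ _ _ _ _ _ l) (lim_cst _ _ _ _ _).
by move=> w [bw _] wv; rewrite Phi_const // => j k; rewrite !cst.
Qed.

Lemma Phibar_chi_out n j (v : 'I_n.+1 -> S) : inB v ->
  (forall k, ~ Sball a l (v k)) -> Phibar (chi a l j) v = 0.
Proof.
move=> bv nv; rewrite -(Phibar_zero C S_balls bv).
apply: (@Phibar_local n l (chi a l j) 0 v) => //; [exact: isC_chi|exact: isC_zero|].
move=> k x xv; apply: chi_out => xa; apply: (nv k).
by apply/(SballE _ xa); split; [exact: bv|rewrite kabsC; exact: xv.2].
Qed.

(** On its ball [chi] is a monic polynomial of degree [j]: its quotient of order [j] is 1 and those
    of higher order vanish. In lower orders each remaining factor t - t(a) contributes at most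
    |pi|^l. *)
Lemma Phibar_chi_in n j (v : 'I_n.+1 -> S) : (forall k, Sball a l (v k)) ->
  ((j <= n)%N -> Phibar (chi a l j) v = (j == n)%:R) /\
  cabs (Phibar (chi a l j) v) <= pirad (l * (j%:Z - n%:Z)).
Proof.
elim: j n v => [|j IH] n v va; have bv := in_Sball_block va.
  suff -> : Phibar (chi a l 0) v = (0 == n)%:R.
    split => //; case: eqP => [<-|_]; rewrite ?cabs1 ?cabs0 ?subrr ?mulr0 ?pirad0 //.
    exact/ltW/pirad_gt0.
  apply: (Phibar_uniq S_balls) => //; first exact: isC_chi.
  apply: (@lim_near _ _ _ _ _ _ _ _ _ l) (lim_cst _ _ _ _ _) => w [bw _] wv.
  have wa k : chi a l 0 (w k) = 1.
    by rewrite chi_in ?expr0 //; split; [exact: bw|exact: kabsB_trans (wv k) (va k).2].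
  case: n v va bv w bw wv wa => [|n] v va bv w bw wv wa; first by rewrite /= wa.
  by rewrite Phi_const // => k k'; rewrite !wa.
case: n v va bv => [|n] v va bv.
  rewrite (Phibar0 S_balls) //; last exact: isC_chi.
  split=> //; rewrite chi_in //; elim: j.+1 => [|q IHq].
    by rewrite expr0 cabs1 mulr0 pirad0.
  rewrite exprS cabsM cabs_kC.
  have -> : l * (q.+1%:Z - 0%N%:Z) = l + l * (q%:Z - 0%N%:Z).
    by rewrite -{2}[l]mulr1 -mulrDr; congr (_ * _); lia.
  by rewrite piradD ler_pM ?kabs_ge0 ?cabs_ge0 //; exact: (va ord0).2.
rewrite chiS (Phibar_mul_tco S_balls) //; last exact: isC_chi.
have [IH1 IH1b] := IH _ v va.
have [IH0 IH0b] : ((j <= n)%N -> Phibar (chi a l j) (v \o lift ord0) = (j == n)%:R) /\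
    cabs (Phibar (chi a l j) (v \o lift ord0)) <= pirad (l * (j%:Z - n%:Z)).
  by apply: IH => k; exact: va.
have eqz : l * (j.+1%:Z - n.+1%:Z) = l * (j%:Z - n%:Z) by congr (_ * _); lia.
split=> [|]; last rewrite eqz.
  rewrite ltnS eqSS => jn; have jn1 : (j == n.+1) = false by rewrite ltn_eqF.
  by rewrite IH0 // (IH1 (leqW jn)) jn1 mulr0 add0r.
apply: cabsD_le => //; rewrite cabsM cabs_kC.
have -> : l * (j%:Z - n%:Z) = l + l * (j%:Z - n.+1%:Z).
  by rewrite -{2}[l]mulr1 -mulrDr; congr (_ * _); lia.
by rewrite piradD ler_pM ?kabs_ge0 ?cabs_ge0 //; exact: (va ord0).2.
Qed.

(** At the centre the factor t - t(a) of the Leibniz rule vanishes, so the powers of t - t(a) are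
    dual to the diagonal quotients, and Taylor sums reproduce those of [f] at their centres. *)
Lemma Phibar_chi_center n j :
  Phibar (chi a l j) (fun _ : 'I_n.+1 => a) = (j == n)%:R.
Proof.
have aa := Sball_refl l ba.
elim: j n => [|j IH] n.
  by rewrite (Phibar_chi_in _ (fun=> aa)).1.
case: n => [|n].
  rewrite (Phibar0 S_balls) //; last exact: isC_chi.
  by rewrite chi_in // subrr /kC !rmorph0 expr0n.
rewrite chiS (Phibar_mul_tco S_balls) //; last exact: isC_chi.
by rewrite subrr /kC !rmorph0 mul0r add0r IH.
Qed.

Lemma Phibar_chi_le n j (v : 'I_n.+1 -> S) : inB v ->
  cabs (Phibar (chi a l j) v) <= pirad (l * (j%:Z - n%:Z)).
Proof.
move=> bv; rewrite -[leRHS]mul1r.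
apply: (Phibar_scaled_bound (p := n)) => // [|{}n {bv}v _ vv]; first exact: isC_chi.
rewrite mul1r; have [va|nva] := pselect (Sball a l (v ord0)).
  by apply: (Phibar_chi_in _ _).2 => k; apply/(SballE _ va).
rewrite Phibar_chi_out ?cabs0 ?ltW ?pirad_gt0 //; first exact: in_Sball_block vv.
move=> k ka; apply: nva; apply/(SballE _ ka); split; first exact: (vv ord0).1.
by rewrite kabsC; exact: (vv k).2.
Qed.

End Chi.
End LocalEstimates.
(** * Approximation by Taylor sums *)

Section TaylorSums.
Variables (R : realType) (F : finFieldType) (C : Cinfty R F).
Variables (S : set (P1 R F)) (m : nat) (c : 'I_m -> P1 R F) (l0 : int) (h : nat).
Hypothesis S_balls : ball_decomposition S c l0.

Local Notation pirad := (pirad R F).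
Local Notation kabs := (@kabs R F).
Local Notation cabs := (@cabs R F C).
Local Notation tco := (@tco R F S m c l0).
Local Notation block := (@block R F S m c l0).
Local Notation inB := (@in_block R F S m c l0).
Local Notation Phibar := (@Phibar R F C S m c l0).
Local Notation Sball := (@Sball R F S m c l0).
Local Notation chi := (@chi R F C S m c l0).
Local Notation isC := (@isC R F C S m c l0).
Local Notation CS := (Cspace C S c l0 h).
Implicit Types f g : S -> C^o.

Lemma isC_sum i n (I : Type) (s : seq I) (k : I -> C) (e : I -> S -> C^o) :
  (forall p, isC i n (e p)) -> isC i n (\sum_(p <- s) k p *: e p).
Proof.
move=> eC; elim: s => [|p s IH]; first by rewrite big_nil; exact: isC_zero.
by rewrite big_cons; exact: isC_linear.
Qed.

Lemma Phibar_sum i n (I : Type) (s : seq I) (k : I -> C) (e : I -> S -> C^o)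
    (v : 'I_n.+1 -> S) : (forall p, isC i n (e p)) -> inB i v ->
  Phibar i (\sum_(p <- s) k p *: e p) v = \sum_(p <- s) k p * Phibar i (e p) v.
Proof.
move=> eC bv; elim: s => [|p s IH]; first by rewrite !big_nil (Phibar_zero C S_balls).
rewrite !big_cons (Phibar_linear S_balls) ?IH //; exact: isC_sum.
Qed.

Lemma isC_chi_all i i' n a l j : block i a -> isC i' n (chi i a l j).
Proof.
move=> ba; have [<-|ii'] := eqVneq i i'; first exact: isC_chi.
move=> v bv; exists 0; apply: lim_eq (lim_cst _ _ _ _ _) => w [bw _].
rewrite -(Phi_zero C c l0 i' w); apply: Phi_ext => k; rewrite chi_out // => -[bk _].
by move/eqP: ii'; apply; exact: block_disjoint bk (bw k).
Qed.

Lemma Phibar_chi_other i i' n a l j (v : 'I_n.+1 -> S) : block i a -> i != i' ->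
  inB i' v -> Phibar i' (chi i a l j) v = 0.
Proof.
move=> ba ii' bv; rewrite -(Phibar_zero C S_balls bv).
apply: (@Phibar_local _ _ _ _ _ _ _ S_balls _ _ l) => //.
- exact: isC_chi_all.
- exact: isC_zero.
move=> k x xv; rewrite chi_out // => -[bx _].
by move/eqP: ii'; apply; exact: block_disjoint bx xv.1.
Qed.

Lemma CspaceE f : (forall i, isC i h f) -> CS f.
Proof. by move=> fC; apply/CspaceP. Qed.

Lemma Cspace_chi i a l j : block i a -> CS (chi i a l j).
Proof. by move=> ba; apply: CspaceE => i'; exact: isC_chi_all. Qed.

Section Points.
Variables (i : 'I_m) (N : nat).

Lemma pt_exists (d : {ffun 'I_N -> F}) : exists x : S, block i x /\
  forall k : 'I_N, tco i x (l0 + k%:Z) = d k.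
Proof.
have [x0 bx0] := block_nonempty S_balls i.
pose z := glue (tco i x0)
  (fun n => oapp d 0 (insub `|n - l0|%N)) l0.
have [x bx xz] := tco_surj S_balls bx0 (kabs_glue R _ _ _ : kabs (z - _) <= _).
exists x; split => // k; rewrite xz glueE ifF; last by lia.
have -> : absz (l0 + k%:Z - l0)%R = k by lia.
by rewrite valK.
Qed.

(** Inside a block, a ball of radius |pi|^(l0+N) is determined by the coefficients of index l0, ...,
    l0 + N - 1; [pt d] is a chosen centre of the ball with coefficients [d]. *)
Definition pt (d : {ffun 'I_N -> F}) : S := projT1 (cid (pt_exists d)).

Lemma pt_block d : block i (pt d).
Proof. by rewrite /pt; case: cid => x []. Qed.

Lemma pt_digit d (k : 'I_N) : tco i (pt d) (l0 + k%:Z) = d k.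
Proof. by rewrite /pt; case: cid => x []. Qed.

Definition digits (x : S) : {ffun 'I_N -> F} := [ffun k : 'I_N => tco i x (l0 + k%:Z)].

Lemma Sball_digits x : block i x -> Sball i (pt (digits x)) (l0 + N%:Z) x.
Proof.
move=> bx; split => //; apply/kabs_lbound => n nN.
rewrite laurent_coefD laurent_coefN; have [nl0|l0n] := ltP n l0.
  have /kabs_lbound/(_ n nl0) := tco_bound bx (pt_block (digits x)).
  by rewrite laurent_coefD laurent_coefN.
have kN : (absz (n - l0) < N)%N by lia.
have := pt_digit (digits x) (Ordinal kN); rewrite ffunE /=.
have -> : l0 + `|n - l0|%N = n by lia.
by move=> ->; rewrite subrr.
Qed.

Lemma digits_Sball d x : Sball i (pt d) (l0 + N%:Z) x -> digits x = d.
Proof.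
move=> [bx /kabs_lbound xd]; apply/ffunP => k; rewrite ffunE -pt_digit.
have := xd (l0 + k%:Z); rewrite laurent_coefD laurent_coefN => /(_ _)/eqP.
by rewrite subr_eq0 => /(_ _)/eqP; apply; rewrite ltrD2l ltz_nat.
Qed.

End Points.

Definition tindex N : finType := ('I_m * {ffun 'I_N -> F} * 'I_h.+1)%type.

(** The diagonal quotient stands for the j-th derivative divided by j!, a division that
    characteristic p forbids for j >= p. *)
Definition tcoef N f (p : tindex N) : C :=
  Phibar p.1.1 f (fun _ : 'I_p.2.+1 => pt p.1.1 p.1.2).

Definition tchi N (p : tindex N) : S -> C^o :=
  chi p.1.1 (pt p.1.1 p.1.2) (l0 + N%:Z) p.2.

Definition taylor N f : S -> C^o := \sum_(p : tindex N) tcoef f p *: tchi p.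

Lemma isC_tchi i n N (p : tindex N) : isC i n (tchi p).
Proof. by apply: isC_chi_all; exact: pt_block. Qed.

Lemma Cspace_taylor N f : CS (taylor N f).
Proof. by apply: CspaceE => i; apply: isC_sum => p; exact: isC_tchi. Qed.

Lemma Phibar_taylor i n N f (d : {ffun 'I_N -> F}) (v : 'I_n.+1 -> S) :
  (forall k, Sball i (pt i d) (l0 + N%:Z) (v k)) ->
  Phibar i (taylor N f) v = \sum_(j < h.+1)
    Phibar i f (fun _ : 'I_j.+1 => pt i d) *
    Phibar i (chi i (pt i d) (l0 + N%:Z) j) v.
Proof.
move=> vd; have bv : inB i v by move=> k; exact: (vd k).1.
rewrite Phibar_sum //; last by move=> p; exact: isC_tchi.
rewrite /tcoef /tchi.
rewrite -(pair_bigA _ (fun (q : 'I_m * {ffun 'I_N -> F}) (j : 'I_h.+1) =>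
  Phibar q.1 f (fun _ : 'I_j.+1 => pt q.1 q.2) *
  Phibar i (chi q.1 (pt q.1 q.2) (l0 + N%:Z) j) v)) /=.
rewrite (bigD1 (i, d)) //= [X in _ + X]big1 ?addr0 // => -[i' d'] /= qd.
apply: big1 => j _; have [ii'|ii'] := eqVneq i' i; last first.
  by rewrite (Phibar_chi_other _ _ (pt_block i' d') ii' bv) mulr0.
move: d' qd; rewrite {}ii' => d' qd.
rewrite (Phibar_chi_out C S_balls) ?mulr0 // => k /digits_Sball.
by rewrite (digits_Sball (vd k)) => dd; move: qd; rewrite dd eqxx.
Qed.

Lemma Phibar_taylor_center i n N f (d : {ffun 'I_N -> F}) : (n <= h)%N ->
  Phibar i (taylor N f) (fun _ : 'I_n.+1 => pt i d) =
  Phibar i f (fun _ : 'I_n.+1 => pt i d).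
Proof.
move=> nh; have dd (k : 'I_n.+1) : Sball i (pt i d) (l0 + N%:Z) (pt i d).
  exact/Sball_refl/pt_block.
rewrite (Phibar_taylor f dd).
rewrite (bigD1 (Ordinal (nh : (n < h.+1)%N))) //= big1 ?addr0.
  by rewrite (Phibar_chi_center C S_balls) ?eqxx ?mulr1 //; exact: pt_block.
move=> j jn; rewrite (Phibar_chi_center C S_balls); last exact: pt_block.
by rewrite (negbTE (jn : val j != n)) mulr0.
Qed.

Lemma Phibar_taylor_top i N f (d : {ffun 'I_N -> F}) (v : 'I_h.+1 -> S) :
  (forall k, Sball i (pt i d) (l0 + N%:Z) (v k)) ->
  Phibar i (taylor N f) v = Phibar i f (fun _ : 'I_h.+1 => pt i d).
Proof.
move=> vd; rewrite (Phibar_taylor f vd).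
rewrite big_ord_recr /= (Phibar_chi_in C S_balls _ vd).1 //.
rewrite eqxx mulr1 big1 ?add0r // => j _.
rewrite (Phibar_chi_in C S_balls _ vd).1 ?ltn_eqF ?mulr0 //.
exact: ltnW (ltn_ord j).
Qed.

Lemma taylor_error N f r : 0 <= r -> CS f ->
  (forall i (d : {ffun 'I_N -> F}) (v : 'I_h.+1 -> S),
    (forall k, Sball i (pt i d) (l0 + N%:Z) (v k)) ->
    cabs (Phibar i f v - Phibar i f (fun _ : 'I_h.+1 => pt i d)) <= r) ->
  forall i n (v : 'I_n.+1 -> S), (n <= h)%N -> inB i v ->
  cabs (Phibar i (f - taylor N f) v) <= r * pirad ((l0 + N%:Z) * (h%:Z - n%:Z)).
Proof.
move=> r0 fC osc i; pose l := l0 + N%:Z.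
have gC : CS (f - taylor N f) by apply: CspaceB => //; exact: Cspace_taylor.
apply: (Phibar_scaled_bound S_balls) => //.
  exact: (Cspace_isC S_balls gC (leqnn h)).
move=> n v nh vv.
pose d := digits i N (v ord0).
have {vv} vd k : Sball i (pt i d) l (v k).
  apply/(SballE _ (Sball_digits N (vv ord0).1)); exact: vv.
rewrite -/l; move: d vd => d.
have rl q : 0 <= r * pirad q by rewrite mulr_ge0 // ltW ?pirad_gt0.
have [q qE] : exists q, (n + q = h)%N by exists (h - n)%N; rewrite subnKC.
elim: q n nh qE v => [|q IH] n nh qE v vd.
  rewrite addn0 in qE; move: v vd; rewrite qE => v vd.
  rewrite subrr mulr0 pirad0 mulr1 (PhibarB S_balls fC) //; last first.
  - by move=> k; exact: (vd k).1.
  - exact: Cspace_taylor.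
  by rewrite (Phibar_taylor_top f vd); exact: osc.
have n1h : (n < h)%N by lia.
have c0 : Phibar i (f - taylor N f) (fun _ : 'I_n.+1 => pt i d) = 0.
  rewrite (PhibarB S_balls fC) ?Phibar_taylor_center ?subrr //.
    exact: Cspace_taylor.
  by move=> k; exact: pt_block.
rewrite -[X in cabs X]subr0 -c0.
have -> : r * pirad (l * (h%:Z - n%:Z)) =
    pirad l * (r * pirad (l * (h%:Z - n.+1%:Z))).
  rewrite mulrCA -piradD; congr (_ * pirad _).
  by rewrite -{2}[l]mulr1 -mulrDr; congr (_ * _); lia.
apply: (Phibar_lipschitz S_balls) => //; first exact: (Cspace_isC S_balls gC n1h).
  exact: pt_block.
by move=> u ud; apply: IH => //; lia.
Qed.

Lemma Cnorm_taylor_cvg f e : CS f -> 0 < e ->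
  exists N0, forall N, (N0 <= N)%N -> Cnorm C S c l0 h (f - taylor N f) <= e.
Proof.
move=> fC e0.
have /choice[n1 n1P] i :=
  Phibar_unif_cont S_balls (Cspace_isC S_balls (i := i) fC (leqnn h)) e0.
(* The summand |l0| makes the radius at most 1, so the power of it in the error bound is at most 1;
   the maximum serves uniform continuity on all blocks at once. *)
exists (`|l0| + \max_i n1 i)%N => N NN.
have lN : 0 <= l0 + N%:Z by lia.
apply: (Cnorm_le S_balls) => [|i n v nh bv]; first exact: ltW.
apply: le_trans (_ : e * pirad ((l0 + N%:Z) * (h%:Z - n%:Z)) <= e).
  apply: taylor_error => //; first exact: ltW.
  move=> {n v nh bv} i' d v vd; apply/ltW/n1P.
  - by move=> k; exact: (vd k).1.
  - by move=> k; exact: pt_block.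
  move=> k; apply: le_trans (vd k).2 _; rewrite pirad_leE.
  by have := @leq_bigmax _ n1 i'; lia.
rewrite ger_pMr // -(pirad0 R F) pirad_leE mulr_ge0 //; lia.
Qed.

Lemma taylor_linear N a f g : CS f -> CS g ->
  taylor N (a *: f + g) = a *: taylor N f + taylor N g.
Proof.
move=> fC gC; rewrite /taylor scaler_sumr -big_split /=; apply: eq_bigr => p _.
rewrite /tcoef (Phibar_linear S_balls).
- by rewrite scalerDl scalerA.
- exact: (Cspace_isC S_balls fC (ltn_ord p.2 : (p.2 <= h)%N)).
- exact: (Cspace_isC S_balls gC (ltn_ord p.2 : (p.2 <= h)%N)).
- by move=> k; exact: pt_block.
Qed.

Lemma taylor0 N : taylor N 0 = 0.
Proof.
apply: big1 => p _; rewrite /tcoef (Phibar_zero C S_balls) ?scale0r //.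
by move=> k; exact: pt_block.
Qed.

(** On each ball of level [N] this function is a polynomial of degree at most h, so its quotient of
    order h does not oscillate there and [taylor_error] applies with r = 0. *)
Lemma taylor_chi N i a l j : block i a -> (j <= h)%N -> l <= l0 + N%:Z ->
  taylor N (chi i a l j) = chi i a l j.
Proof.
move=> ba jh lN; have fC := Cspace_chi l j ba.
have gC := CspaceB S_balls fC (Cspace_taylor N (chi i a l j)).
have err : forall i' n (v : 'I_n.+1 -> S), (n <= h)%N -> inB i' v ->
    cabs (Phibar i' (chi i a l j - taylor N (chi i a l j)) v) <= 0.
  move=> i' n v nh bv; rewrite -[leRHS](mul0r (pirad ((l0 + N%:Z) * (h%:Z - n%:Z)))).
  apply: taylor_error => // {n nh bv}i' d {}v vd.
  have bv : inB i' v by move=> k; exact: (vd k).1.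
  have bd : inB i' (fun _ : 'I_h.+1 => pt i' d) by move=> k; exact: pt_block.
  suff -> : Phibar i' (chi i a l j) v =
      Phibar i' (chi i a l j) (fun _ : 'I_h.+1 => pt i' d) by rewrite subrr cabs0.
  have [ii'|ii'] := eqVneq i i'; last by rewrite !Phibar_chi_other.
  move: d vd bv bd; rewrite -{i'}ii' => d vd bv bd.
  have [da|nda] := pselect (Sball i a l (pt i d)).
    rewrite !(Phibar_chi_in C S_balls _ _).1 // => k.
    apply/(SballE _ da); split; first exact: bv.
    by apply: le_trans (vd k).2 _; rewrite pirad_leE.
  rewrite !(Phibar_chi_out C S_balls) // => k ka; apply: nda.
  apply/(SballE _ ka); split; first exact: pt_block.
  by rewrite kabsC; apply: le_trans (vd k).2 _; rewrite pirad_leE.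
apply/eqP; rewrite eq_sym -subr_eq0; apply/eqP/funext => x.
apply/cabs_eq0/eqP; rewrite eq_le cabs_ge0 andbT.
apply: le_trans (eval_le_Cnorm S_balls x gC) _.
exact: (Cnorm_le S_balls).
Qed.

Lemma locpoly_Cspace f : locpoly C S c l0 h f -> CS f.
Proof.
move=> [l _ [n [k [e [eP ->]]]]]; apply: CspaceE => i; apply: isC_sum => p.
by have [i' [a [j [ba jh ->]]]] := eP p; exact: isC_chi_all.
Qed.

Lemma taylor_locpoly_at N l f : l <= l0 + N%:Z -> locpoly_at c l0 h l f ->
  taylor N f = f.
Proof.
move=> lN [n [k [e [eP ->]]]].
have eC p : CS (e p).
  by have [i' [a [j [ba jh ->]]]] := eP p; exact: Cspace_chi.
elim: (index_enum _) => [|p s IH]; first by rewrite !big_nil taylor0.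
rewrite !big_cons taylor_linear //; last first.
  apply: CspaceE => i; apply: isC_sum => q; exact: (Cspace_isC S_balls (eC q) (leqnn h)).
rewrite IH; congr (_ *: _ + _).
by have [i' [a [j [ba jh ->]]]] := eP p; exact: taylor_chi.
Qed.

Lemma lspan_sum (U : lmodType C) (E : set U) (I : finType) (k : I -> C)
    (e : I -> U) : (forall p, E (e p)) -> lspan E (\sum_p k p *: e p).
Proof.
move=> eE; exists #|I|, (k \o enum_val), (e \o enum_val); split=> [p|]; first exact: eE.
by rewrite (reindex _ (onW_bij _ (@enum_val_bij I))).
Qed.

Lemma locpoly_at_taylor N f : locpoly_at c l0 h (l0 + N%:Z) (taylor N f).
Proof.
apply: lspan_sum => -[[i d] j] /=; exists i, (pt i d), (j : nat).
by split => //; [exact: pt_block|rewrite -ltnS ltn_ord].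
Qed.

Lemma locpoly_taylor N f : locpoly C S c l0 h (taylor N f).
Proof. by exists (l0 + N%:Z); [rewrite /= lerDl|exact: locpoly_at_taylor]. Qed.

Lemma locpoly_chi i a l j : block i a -> (j <= h)%N -> l0 <= l ->
  locpoly C S c l0 h (chi i a l j).
Proof.
move=> ba jh ll; exists l => //.
exists 1%N, (fun=> 1), (fun=> chi i a l j); split; last by rewrite big_ord1 scale1r.
by move=> _; exists i, a, j.
Qed.

Lemma taylor_locpoly f : locpoly C S c l0 h f ->
  exists N0, forall N, (N0 <= N)%N -> taylor N f = f.
Proof.
move=> [l _ fl]; exists `|l - l0|%N => N lN; apply: taylor_locpoly_at fl; lia.
Qed.

(** Elements of different levels are both their own Taylor sums at a common level, where [taylor] is
    linear. *)
Lemma locpoly_submod : submod_closed (mem (locpoly C S c l0 h)).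
Proof.
split=> [|a f g]; rewrite !inE; first by rewrite -(taylor0 0); exact: locpoly_taylor.
move=> fP gP; have [[n1 fn1] [n2 gn2]] := (taylor_locpoly fP, taylor_locpoly gP).
rewrite -(fn1 (maxn n1 n2)) ?leq_maxl // -(gn2 (maxn n1 n2)) ?leq_maxr //.
rewrite -taylor_linear; [exact: locpoly_taylor|exact: locpoly_Cspace..].
Qed.

(** As |pi|^l <= 1, the bounds |pi|^(l(j-n)) for n <= h are largest at n = h, which is exactly the
    exponent in the definition of admissibility. *)
Lemma Cnorm_chi i a l j : block i a -> 0 <= l -> (j <= h)%N ->
  Cnorm C S c l0 h (chi i a l j) <= pirad (l * (j%:Z - h%:Z)).
Proof.
move=> ba l_ge0 jh; apply: (Cnorm_le S_balls); first exact/ltW/pirad_gt0.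
move=> i' n v nh bv; have [ii'|ii'] := eqVneq i i'; last first.
  by rewrite Phibar_chi_other // cabs0 ltW ?pirad_gt0.
move: bv; rewrite -{i'}ii' => bv.
apply: le_trans (Phibar_chi_le C S_balls a l j bv) _.
rewrite pirad_leE ler_wpM2l //; lia.
Qed.

End TaylorSums.
(** * Duality *)

Section ExtendByZero.
Variables (R : realType) (F : finFieldType) (C : Cinfty R F) (U : lmodType C).
Variables (V : set U) (L : V -> C^o).
Hypotheses (V_submod : submod_closed (mem V)) (L_linear : linear_on L).

(* L extended by 0, to avoid carrying membership proofs *)
Definition ext (f : U) : C^o :=
  if pselect (V f) is left Vf then L (SigSub (mem_set Vf)) else 0.

Lemma ext_val (f : V) : ext (\val f) = L f.
Proof.
rewrite /ext; case: pselect => [Vf|[]]; last exact: set_valP.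
by congr L; exact: val_inj.
Qed.

Lemma ext_SigSub f (Vf : f \in V) : L (SigSub Vf) = ext f.
Proof. by rewrite -ext_val. Qed.

Lemma submod_linear a f g : V f -> V g -> V (a *: f + g).
Proof. by move=> Vf Vg; apply/set_mem/V_submod.2; rewrite inE. Qed.

Lemma submod0 : V 0. Proof. by apply/set_mem/V_submod.1. Qed.

Lemma ext_linear a f g : V f -> V g -> ext (a *: f + g) = a * (ext f : C) + ext g.
Proof.
move=> Vf Vg; have Vfg := submod_linear a Vf Vg.
by rewrite -(ext_SigSub (mem_set Vf)) -(ext_SigSub (mem_set Vg))
  -(ext_SigSub (mem_set Vfg)); exact: L_linear.
Qed.

Lemma ext0 : ext 0 = 0.
Proof.
have := ext_linear 1 submod0 submod0; rewrite scaler0 addr0 mul1r.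
by move/eqP; rewrite -subr_eq subrr eq_sym => /eqP.
Qed.

Lemma extZ a f : V f -> ext (a *: f) = a * (ext f : C).
Proof.
by move=> Vf; rewrite -[a *: f]addr0 ext_linear ?ext0 ?addr0 //; exact: submod0.
Qed.

Lemma extB f g : V f -> V g -> ext (f - g) = (ext f : C) - ext g.
Proof.
by move=> Vf Vg; rewrite -scaleN1r addrC ext_linear // mulN1r addrC.
Qed.

Lemma ext_sum (I : Type) (s : seq I) (k : I -> C) (e : I -> U) :
  (forall p, V (e p)) -> V (\sum_(p <- s) k p *: e p) /\
  ext (\sum_(p <- s) k p *: e p) = \sum_(p <- s) k p * (ext (e p) : C).
Proof.
move=> eV; elim: s => [|p s [IHV IH]].
  by rewrite !big_nil ext0; split => //; exact: submod0.
by rewrite !big_cons ext_linear // IH; split => //; exact: submod_linear.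
Qed.

End ExtendByZero.

Section CinftyLimits.
Variables (R : realType) (F : finFieldType) (C : Cinfty R F).
Local Notation cvg := (cvg_for (@cabs R F C)).
Implicit Types u v : nat -> C.

Lemma cvg_uniq u y z : cvg u y -> cvg u z -> y = z.
Proof.
move=> uy uz; apply: cabs_lt_eq => e e0.
have [[n1 H1] [n2 H2]] := (uy e e0, uz e e0).
apply: (@cabsB_lt _ _ _ (u (maxn n1 n2))); rewrite cabsC;
  by [apply: H1; rewrite leq_maxl|apply: H2; rewrite leq_maxr].
Qed.

Lemma cvg_linear a u v y z : cvg u y -> cvg v z ->
  cvg (fun n => a * u n + v n) (a * y + z).
Proof.
move=> uy vz e e0; have d0 : 0 < cabs a + 1 by rewrite ltr_wpDl ?cabs_ge0.
have [[n1 H1] [n2 H2]] := (uy _ (divr_gt0 e0 d0), vz e e0).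
exists (maxn n1 n2) => n; rewrite geq_max => /andP[/H1 Hu /H2 Hv].
have -> : a * u n + v n - (a * y + z) = a * (u n - y) + (v n - z) by ring.
apply: cabsD_lt => //; rewrite cabsM.
apply: le_lt_trans (_ : (cabs a + 1) * cabs (u n - y) < e).
  by rewrite ler_wpM2r ?cabs_ge0 // lerDl.
by rewrite mulrC -ltr_pdivlMr.
Qed.

Lemma cvg_eventually u y n0 : (forall n, (n0 <= n)%N -> u n = y) -> cvg u y.
Proof. by move=> uy e e0; exists n0 => n /uy ->; rewrite subrr cabs0. Qed.

Lemma cvg_le u y n0 r : (forall n, (n0 <= n)%N -> cabs (u n) <= r) -> cvg u y ->
  cabs y <= r.
Proof.
move=> ur uy; rewrite leNgt; apply/negP => ry.
have r0 : 0 <= r by apply: le_trans (ur _ (leqnn _)); exact: cabs_ge0.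
have [n1 H1] := uy _ (le_lt_trans r0 ry).
have : cabs y < cabs y.
  rewrite -{1}(subKr (u (maxn n0 n1)) y); apply: cabsD_lt.
    by apply: le_lt_trans ry; apply: ur; rewrite leq_maxl.
  by rewrite cabsN; apply: H1; rewrite leq_maxr.
by rewrite ltxx.
Qed.

End CinftyLimits.

Section Duality.
Variables (R : realType) (F : finFieldType) (C : Cinfty R F).
Variables (S : set (P1 R F)) (m : nat) (c : 'I_m -> P1 R F) (l0 : int) (h : nat).
Hypothesis S_balls : ball_decomposition S c l0.

Local Notation pirad := (pirad R F).
Local Notation cabs := (@cabs R F C).
Local Notation CS := (Cspace C S c l0 h).
Local Notation LP := (locpoly C S c l0 h).
Local Notation N := (Cnorm C S c l0 h).
Local Notation taylor := (@taylor R F C S m c l0 h S_balls).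
Implicit Types f g : S -> C^o.

Let CSV := Cspace_submod C h S_balls.
Let LPV := locpoly_submod C h S_balls.
Let PC : LP `<=` CS := @locpoly_Cspace R F C S m c l0 h S_balls.

Section Restriction.
Variable L : CS -> C^o.
Hypothesis L_dual : Cdual C S c l0 h L.

(** Scaling by powers of pi turns continuity at 0 into a bound; norms are compared with powers of
    |pi| only, which is enough for the functions [chi]. *)
Lemma Cdual_bounded : exists K : int, forall f (l : int), CS f -> N f <= pirad l ->
  cabs (ext L f) <= pirad (l - K).
Proof.
have [L_lin L_cont] := L_dual.
have [d d0 dP] := L_cont (SigSub (mem_set (submod0 CSV))) 1 ltr01.
have [k kd] := pirad_lt F d0; exists k%:Z => f l fC fl.
(* Multiplication by pi^(k-l) brings a norm of at most |pi|^l to at most |pi|^k, which is below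
   [d]. *)
pose a := kC C (monom 1 (k%:Z - l)).
have ca : cabs a = pirad (k%:Z - l) by rewrite cabs_kC kabs_monom1.
have afC : CS (a *: f) by exact: CspaceZ.
have := dP (SigSub (mem_set afC)).
rewrite !ext_SigSub /= subr0 (ext0 CSV) // subr0 (extZ CSV) // cabsM ca.
rewrite CnormZ // ca => /(_ _)/ltW.
have -> : pirad (l - k%:Z) = (pirad (k%:Z - l))^-1 by rewrite -piradN opprB.
rewrite -ler_pdivlMl ?pirad_gt0 // mulr1; apply.
apply: le_lt_trans kd; apply: le_trans (_ : pirad (k%:Z - l) * pirad l <= _).
  by rewrite ler_wpM2l // ltW ?pirad_gt0.
by rewrite -piradD subrK.
Qed.

Lemma restriction_admissible : admissible C S c l0 h (restriction PC L).
Proof.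
have [L_lin L_cont] := L_dual; split.
  by move=> a f g k kE; apply: L_lin; rewrite /= kE.
have [K KP] := Cdual_bounded; exists (pirad (- K)), 0 => i a l j f ba _ l_ge0 jh fE.
rewrite /restriction ext_SigSub fE -piradD [- K + _]addrC.
by apply: KP; [exact: Cspace_chi|exact: Cnorm_chi].
Qed.

End Restriction.

Lemma Cnorm_sym f g : CS f -> CS g -> N (f - g) = N (g - f).
Proof.
move=> fC gC; rewrite -opprB -scaleN1r CnormZ ?cabsN ?cabs1 ?mul1r //.
exact: CspaceB.
Qed.

Lemma restriction_inj :
  {in Cdual C S c l0 h &, injective (restriction PC : (CS -> C^o) -> _)}.
Proof.
move=> L1 L2; rewrite !inE => -[L1_lin L1_cont] [L2_lin L2_cont] L12.
apply/funext => f; apply: cabs_lt_eq => e e0.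
have [d1 d10 d1P] := L1_cont f e e0; have [d2 d20 d2P] := L2_cont f e e0.
have fC : CS (\val f) := set_valP f.
have d0 : 0 < Num.min d1 d2 / 2 by rewrite divr_gt0 // lt_min d10.
have [n0 /(_ n0 (leqnn _)) nP] := Cnorm_taylor_cvg S_balls fC d0.
have pP := locpoly_taylor h S_balls n0 (\val f).
pose p : CS := SigSub (mem_set (PC pP)).
have pf : N (\val p - \val f) < Num.min d1 d2.
  rewrite Cnorm_sym //=; last exact: PC.
  by apply: le_lt_trans nP _; rewrite ltr_pdivrMr // mulr_natr mulr2n ltrDl lt_min d10.
have Lp : L1 p = L2 p.
  have := congr1 (fun M => M (SigSub (mem_set pP))) L12; rewrite /restriction /=.
  by congr (L1 _ = L2 _); exact: val_inj.
move: pf; rewrite lt_min => /andP[/d1P H1 /d2P H2].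
by apply: (@cabsB_lt _ _ _ (L1 p)); rewrite cabsC // Lp.
Qed.

Section Extension.
Variable mu : LP -> C^o.
Hypothesis mu_adm : admissible C S c l0 h mu.

Let mu_lin : linear_on mu := mu_adm.1.

(* The difference of two successive Taylor sums has, on each ball of the finer
   radius r/q, coefficients at most |f| r^(h-j), against which mu is bounded by
   a constant times |f| (r/q)^(j-h) r^(h-j) <= |f| q^h. *)
Lemma taylor_bounded : exists (K : R) (n0 : nat), 0 <= K /\
  forall f n, CS f -> (n0 <= n)%N -> cabs (ext mu (taylor n f)) <= K * N f.
Proof.
have [_ [M [l1 muP]]] := mu_adm.
pose M0 := Num.max 0 M; have M0_ge0 : 0 <= M0 by rewrite le_max lexx.
(* From [n0] on the level l0 + n is at least l1, where admissibility applies, and at least 0. *)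
pose n0 := (`|l0| + `|l1|)%N.
have term n r (g : S -> C^o) : (n0 <= n)%N -> 0 <= r ->
    (forall p : tindex F m h n, cabs (tcoef S_balls g p) *
      pirad ((l0 + n%:Z) * ((p.2 : nat)%:Z - h%:Z)) <= r) ->
    cabs (ext mu (taylor n g)) <= M0 * r.
  move=> nn r0 gr.
  have tP (p : tindex F m h n) : LP (tchi C S_balls p).
    apply: locpoly_chi => //; first exact: pt_block.
      by rewrite -ltnS ltn_ord.
    by rewrite lerDl.
  rewrite (ext_sum LPV mu_lin _ _ _).2 //.
  apply: cabs_sum => [|p _]; first exact: mulr_ge0.
  rewrite cabsM; apply: le_trans (_ : cabs (tcoef S_balls g p) *
    (M0 * pirad ((l0 + n%:Z) * ((p.2 : nat)%:Z - h%:Z))) <= _); last first.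
    by rewrite mulrCA ler_wpM2l.
  rewrite ler_wpM2l ?cabs_ge0 // -(ext_SigSub mu (mem_set (tP p))).
  apply: le_trans (_ : M * pirad ((l0 + n%:Z) * ((p.2 : nat)%:Z - h%:Z)) <= _).
    apply: (muP p.1.1 (pt S_balls p.1.1 p.1.2)) => //; first exact: pt_block.
    - by rewrite lerDl.
    - by rewrite /n0 in nn; lia.
    - by rewrite -ltnS ltn_ord.
  by rewrite ler_wpM2r ?(ltW (pirad_gt0 _ _ _)) // le_max lexx orbT.
pose k0 : int := l0 + n0%:Z.
have k0_ge0 : 0 <= k0 by rewrite /k0 /n0; lia.
(* [K1] bounds the weights |pi|^(k0 (j - h)) of the initial sum; [K2], which is q^h, serves the
   later increments. *)
pose K1 := pirad (- (k0 * h%:Z)); pose K2 := pirad (- h%:Z).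
have K10 : 0 <= K1 by rewrite ltW ?pirad_gt0.
have K20 : 0 <= K2 by rewrite ltW ?pirad_gt0.
exists (M0 * Num.max K1 K2), n0; split; first by rewrite mulr_ge0 // le_max K10.
move=> f n fC; have Nf0 := Cnorm_ge0 c l0 h f => nn.
rewrite -(subnKC nn) -mulrA; elim: (n - n0)%N => [|q IH] {n nn}.
  rewrite addn0; apply: term => //; first by rewrite mulr_ge0 // le_max K10.
  move=> p; rewrite mulrC ler_pM ?cabs_ge0 ?(ltW (pirad_gt0 _ _ _)) //.
    rewrite le_max pirad_leE -/k0 -mulrN ler_wpM2l //; lia.
  apply: (Phibar_le_Cnorm S_balls) => //; first by rewrite -ltnS ltn_ord.
  by move=> k; exact: pt_block.
rewrite addnS; set n := (n0 + q)%N in IH *.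
have gC : CS (f - taylor n f) by apply: CspaceB => //; exact: Cspace_taylor.
(* [taylor n.+1] fixes [taylor n f], so the increment is the Taylor sum of the error, whose
   coefficients [taylor_error] controls. *)
have -> : taylor n.+1 f = taylor n.+1 (f - taylor n f) + taylor n f.
  have {2}-> : taylor n f = taylor n.+1 (taylor n f).
    rewrite (taylor_locpoly_at _ _ (locpoly_at_taylor _ _ _ _)) //.
    by rewrite lerD2l lez_nat leqnSn.
  rewrite -[LHS]subr0 -[X in _ = X + _]scale1r -taylor_linear ?scale1r ?subrK ?subr0 //.
  exact: Cspace_taylor.
rewrite -[taylor n.+1 (f - _)]scale1r (ext_linear LPV mu_lin);
  [|exact: locpoly_taylor..].
(* A maximum and not a sum, so the bound stays the same at every level. *)
rewrite mul1r; apply: cabsD_le => //.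
apply: term => //; first by rewrite /n; lia.
  by rewrite mulr_ge0 // le_max K10.
move=> p; have ph : (p.2 <= h)%N by rewrite -ltnS ltn_ord.
apply: le_trans (_ : N f * pirad ((l0 + n%:Z) * (h%:Z - (p.2 : nat)%:Z)) *
    pirad ((l0 + n.+1%:Z) * ((p.2 : nat)%:Z - h%:Z)) <= _).
  rewrite ler_wpM2r ?(ltW (pirad_gt0 _ _ _)) //.
  apply: taylor_error => //; last by move=> k; exact: pt_block.
  move=> i d v vd; apply: cabsB_le; apply: (Phibar_le_Cnorm S_balls) => //.
    by move=> k; exact: (vd k).1.
  by move=> k; exact: pt_block.
rewrite -mulrA mulrC ler_wpM2r // -piradD le_max; apply/orP; right.
rewrite pirad_leE.
have -> : (l0 + n%:Z) * (h%:Z - (p.2 : nat)%:Z) +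
  (l0 + n.+1%:Z) * ((p.2 : nat)%:Z - h%:Z) = (p.2 : nat)%:Z - h%:Z.
  have -> : n.+1%:Z = n%:Z + 1 by lia.
  by ring.
by lia.
Qed.

Lemma extension_cvg f : CS f ->
  exists y, cvg_for cabs (fun n => ext mu (taylor n f)) y.
Proof.
move=> fC; have [K [n0 [K0 KP]]] := taylor_bounded.
have [//||y _ yP] := @Cinf_complete R F C (fun n => ext mu (taylor n f));
  last by exists y.
have K1 : 0 < K + 1 by rewrite ltr_wpDl.
suff close_to e : 0 < e -> exists n1, forall n, (n1 <= n)%N ->
    cabs (ext mu (taylor n f) - ext mu (taylor n1 f)) < e.
  move=> e /close_to[n1 H]; exists n1 => n n' /H nH /H n'H.
  exact: cabsB_lt nH n'H.
(* [K] may be 0, hence K + 1; the factor 2 makes up for the non-strict estimate of the norm. *)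
move=> e0; have e1 := divr_gt0 e0 (mulr_gt0 (ltr0Sn R 1) K1).
have [n1 H1] := Cnorm_taylor_cvg S_balls fC e1.
exists (maxn n0 n1) => n nn; set n2 := maxn n0 n1 in nn *.
have gC : CS (f - taylor n2 f) by apply: CspaceB => //; exact: Cspace_taylor.
have E : taylor n (f - taylor n2 f) = taylor n f - taylor n2 f.
  have {2}<- : taylor n (taylor n2 f) = taylor n2 f.
    by apply: taylor_locpoly_at (locpoly_at_taylor _ _ _ _); rewrite lerD2l lez_nat.
  rewrite -scaleN1r addrC taylor_linear //; last exact: Cspace_taylor.
  by rewrite scaleN1r addrC.
rewrite -(extB LPV mu_lin); [|exact: locpoly_taylor..].
rewrite -E; apply: le_lt_trans (KP _ _ gC _) _.
  by apply: leq_trans nn; rewrite leq_maxl.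
have := H1 n2 (leq_maxr _ _); rewrite ler_pdivlMr ?mulr_gt0 // => H2.
have := Cnorm_ge0 c l0 h (f - taylor n2 f); nra.
Qed.

Lemma restriction_surj : exists2 L : CS -> C^o, Cdual C S c l0 h L &
  restriction PC L = mu.
Proof.
have [K [n0 [K0 KP]]] := taylor_bounded.
have /choice[L LP_] (f : CS) : exists y : C^o,
    cvg_for cabs (fun n => ext mu (taylor n (\val f))) y.
  exact: extension_cvg (set_valP f).
have L_lin : linear_on L.
  move=> a f g k kE; apply: cvg_uniq (LP_ k) _.
  have := cvg_linear a (LP_ f) (LP_ g); congr (cvg_for _ _ _).
  apply/funext => n; rewrite kE taylor_linear ?(ext_linear LPV mu_lin) //;
    first [exact: locpoly_taylor|exact: set_valP].
have L_le (f : CS) : cabs (L f) <= K * N (\val f).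
  by apply: cvg_le (LP_ f) => n; apply: KP; exact: set_valP.
exists L.
  split=> // f e e0; have K1 : 0 < K + 1 by rewrite ltr_wpDl.
  exists (e / (K + 1)) => [|g gf]; first exact: divr_gt0.
  have gfC : CS (\val g - \val f) by apply: CspaceB => //; exact: set_valP.
  have -> : L g - L f = L (SigSub (mem_set gfC)).
    rewrite (L_lin 1 (SigSub (mem_set gfC)) f g) ?mul1r ?addrK //.
    by rewrite scale1r subrK.
  apply: le_lt_trans (L_le _) _ => /=.
  move: gf; rewrite ltr_pdivlMr // => gf.
  have := Cnorm_ge0 c l0 h (\val g - \val f); nra.
apply/funext => p; rewrite /restriction; apply: cvg_uniq (LP_ _) _ => /=.
(* For an element of P^(h) the sequence is eventually constant, equal to [mu p]. *)
have [n1 n1P] := taylor_locpoly S_balls (set_valP p).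
by apply: (@cvg_eventually _ _ _ _ _ n1) => n /n1P ->; rewrite ext_val.
Qed.

End Extension.
End Duality.

Theorem theorem4p4 (R : realType) (F : finFieldType) (C : Cinfty R F)
    (S : set (P1 R F)) (S_nonempty : S !=set0) (S_open : open S)
    (S_compact : compact S)
    (m : nat) (c : 'I_m -> P1 R F) (l0 : int)
    (S_balls : ball_decomposition S c l0) (h : nat) :
  banach (Cspace C S c l0 h) (Cnorm C S c l0 h) /\
  submod_closed (mem (locpoly C S c l0 h)) /\
  exists PC : locpoly C S c l0 h `<=` Cspace C S c l0 h,
    linear (restriction PC :
      (Cspace C S c l0 h -> C^o) -> (locpoly C S c l0 h -> C^o)) /\
    set_bij (Cdual C S c l0 h) (admissible C S c l0 h) (restriction PC).
Proof.
split; first exact: Cspace_banach.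
split; first exact: locpoly_submod.
exists (@locpoly_Cspace R F C S m c l0 h S_balls); split; first by [].
split; first exact: restriction_admissible.
  exact: restriction_inj.
by move=> mu /restriction_surj[L Ld Lmu]; exists L.
Qed.
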